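(* The rectilinear crossing number satisfies $$\overline{\mathrm{cr}}(n)\ \ge\ \frac{277}{729}\binom n4+\Theta(n^3)\ >\ 0.379972\binom n4+\Theta(n^3).$$ That is, $\frac{277}{729}>0.379972$ and there is a constant $C>0$ such that $\overline{\mathrm{cr}}(n)\ge \frac{277}{729}\binom n4-Cn^3$ for all positive integers $n$.
   Context: For a finite set $P$ of points in general position in the plane (no three collinear), $\mathrm{cr}(P)$ is the number of crossings obtained when all straight line segments joining pairs of points of $P$ are drawn, where a crossing is the intersection of two segments in their interiors (counted as pairs of crossing segments, equivalently the number of convex quadrilaterals with vertices in $P$). The rectilinear crossing number is $\overline{\mathrm{cr}}(n)=\min\{\mathrm{cr}(P): |P|=n\}$, the minimum over all sets $P$ of $n$ points in general position in the plane. In the claim, $\Theta(n^3)$ stands for an unspecified error term of order at most $n^3$, with no assertion about its sign. *)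

(* Defs.v *)
From HB Require Import structures.
From mathcomp Require Import all_boot all_order all_algebra finmap.
From mathcomp Require Import all_classical all_reals.
From mathcomp Require Import ring lra.

Set Implicit Arguments.
Unset Strict Implicit.
Unset Printing Implicit Defensive.

Import Order.TTheory GRing.Theory Num.Theory.

Local Open Scope classical_set_scope.
Local Open Scope fset_scope.
Local Open Scope ring_scope.

Section RectilinearCrossing.
Variable R : realType.

Local Notation point := (R * R)%type.

Definition collinear (p q r : point) : Prop :=
  exists a b c : R, (a, b) != (0, 0) /\
    [/\ a * p.1 + b * p.2 = c, a * q.1 + b * q.2 = c & a * r.1 + b * r.2 = c].

Definition general_position (P : {fset point}) : Prop :=
  forall p q r : point, p \in P -> q \in P -> r \in P ->
    p != q -> p != r -> q != r -> ~ collinear p q r.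

Definition open_segment (p q : point) : set point :=
  [set z | exists t : R, 0 < t < 1 /\
     z = ((1 - t) * p.1 + t * q.1, (1 - t) * p.2 + t * q.2)].

(* Segments are represented by the two-element sets of their endpoints. *)
Definition edges (P : {fset point}) : {fset {fset point}} :=
  [fset e in fpowerset P | #|` e| == 2%N].

Definition cross (e f : {fset point}) : Prop :=
  exists p q r s : point, [/\ e = [fset p; q], f = [fset r; s] &
    open_segment p q `&` open_segment r s !=set0].

(* Crossings are unordered pairs [fset e; f] of distinct segments. *)
Definition crossings (P : {fset point}) : {fset {fset {fset point}}} :=
  [fset X in fpowerset (edges P) |
     (#|` X| == 2%N) && `[< exists e f, X = [fset e; f] /\ cross e f >]].

Definition cr (P : {fset point}) : nat := #|` crossings P|.

Definition cr_attained (n : nat) : pred nat := fun k =>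
  `[< exists P : {fset point}, [/\ #|` P| = n, general_position P & cr P = k] >].

(* Witness: n points on the parabola y = x^2. *)
Lemma cr_attained_ex (n : nat) : exists k, cr_attained n k.
Proof.
pose f (i : nat) : point := (i%:R, i%:R ^+ 2).
have f_inj : injective f.
  by move=> i j [] /eqP; rewrite eqr_nat => /eqP.
pose P : {fset point} := [fset x | x in [seq f i | i <- iota 0 n]].
have Psize : #|` P| = n.
  rewrite card_fseq undup_id ?size_map ?size_iota //.
  by rewrite map_inj_uniq // iota_uniq.
exists (cr P); apply/asboolP; exists P; split=> // p q r.
rewrite !inE /= => /mapP[i _ ->] /mapP[j _ ->] /mapP[k _ ->].
rewrite !(inj_eq f_inj) => ij ik jk [a [b [c [ab0 [/= Ei Ej Ek]]]]].
have neq (x y : nat) : x != y -> (x%:R - y%:R : R) != 0.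
  by rewrite subr_eq0 eqr_nat.
have sep (x y : nat) : x != y ->
    a * x%:R + b * x%:R ^+ 2 = c -> a * y%:R + b * y%:R ^+ 2 = c ->
    a + b * (x%:R + y%:R) = 0.
  move=> /neq xy Ex Ey; apply: (mulfI xy); rewrite mulr0.
  by rewrite -(subrr c) -{1}Ex -Ey; ring.
have Eij := sep _ _ ij Ei Ej; have Eik := sep _ _ ik Ei Ek.
have b0 : b = 0.
  apply: (mulfI (neq _ _ jk)); rewrite mulr0.
  by rewrite -(subrr (0 : R)) -{1}Eij -Eik; ring.
have a0 : a = 0 by rewrite -Eij b0 mul0r addr0.
by rewrite a0 b0 eqxx in ab0.
Qed.

Definition rectilinear_cr (n : nat) : nat := ex_minn (cr_attained_ex n).

End RectilinearCrossing.

(* Main.v *)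
Require Import Defs.
From mathcomp Require Import all_boot all_order all_algebra.
From mathcomp Require Import all_classical all_reals.
From mathcomp Require Import finmap zify ring lra.

Set Implicit Arguments.
Unset Strict Implicit.
Unset Printing Implicit Defensive.

Import Order.TTheory GRing.Theory Num.Theory.

(** Why the bound holds.

    Among the six pairs of a set of four points in general position, two separate
    the other two points if the four points are in convex position, and three do
    otherwise.  Counting separations over all quadruples therefore turns the number
    of crossings into 3 'C(n, 4) minus the sum, over all pairs of points, of the
    product of the numbers of points on the two sides of their line
    ([falling_le_cr], [num_separations_left]).  This sum is a positive combination
    of the numbers U(m) of ordered pairs with at least m points on both sides
    ([sum_ell_mul]), so everything rests on upper bounds for U(m).  All pairs are
    ordered: the pair (q, p) has on its left what (p, q) has on its right.

    Both bounds come from projecting the points onto a rotating line.  The order of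
    the projections changes by swaps of neighbours, and two points p, q with j
    points on the left of pq swap when they occupy positions j and j + 1.

    First bound ([card_pairs_le]): up to an error linear in m, at least
    (9 m^2 + (3 m - n)^2) / 6 ordered pairs have at most m points on their left,
    where 3 m - n is replaced by 0 when negative.  This is an induction that
    deletes three extreme points a, b, c, no half-plane with few points containing
    all of them.  Each of the three lies in about 2 m such pairs, and every other
    pair loses at most two points on its left, so the pairs with at most m - 2
    points on the left after the deletion all count.  In addition, at least about
    3 m - n pairs with exactly m points on the left have at most one of a, b, c
    there.  They are found as follows: follow the set of the first k = m + 1
    points through three stretches of the rotation during which it contains at
    most one of a, b, c.  Each stretch begins when one extreme point leaves this
    set and ends when another enters it, and the set at the beginning of a stretch
    is disjoint from the set at the end of the next one, because the k points first
    met on the two sides of an extreme point are different.  So the three sets of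
    points that survive a stretch are disjoint, and all other points must have left
    by a swap of the wanted kind.

    Second bound ([card_pairs_mid_le], [card_pairs_mid_pairs_eq]): with K = n - 2 m, either U(m) <= 2 n K or
    K U(m) <= (K - 1) U(m - 1).  Charge each swap inside the K middle positions to
    the last entrance of one of its two points into the middle.  An entrance finds
    K - 1 other points there and can be charged once for each of them.  Points that
    never leave the middle are few enough to be treated apart.

    The second bound alone forces the decay of U along the square root of K, and it
    improves on the first from m = 4 n / 9 on, where the two have equal slope.  The
    first bound is summed below 4 n / 9, and above it K^2 U(m) / 5 is a potential
    whose decrements dominate the terms of the sum ([weighted_sum_le]).  The result
    is the coefficient 277 / 729. *)

(** * Allowable sequences *)

(** The Goodman-Pollack encoding of a point set, unrolled over all times:
    [before t] is the order of the projections after [t] swaps.  A half-turn takes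
    [half] swaps and reverses the order.  One pair swaps at a time: swaps that a
    point set performs simultaneously, on parallel lines, are put in some order.
    [before_convex] expresses that a pair swaps at most once in a half-turn. *)
Record allowable_sequence (T : finType) := AllowableSequence {
  half : nat;
  before : nat -> rel T;
  swap_time : T -> T -> nat;
  before_irr : forall t p, before t p p = false;
  before_total : forall t p q, p != q -> before t p q = ~~ before t q p;
  before_trans : forall t, transitive (before t);
  before_half : forall t p q, before (t + half) p q = before t q p;
  before_convex : forall t1 t2 t3 p q, t1 <= t2 <= t3 -> t3 <= t1 + half ->
    before t1 p q -> before t3 p q -> before t2 p q;
  swap_timeP : forall p q, p != q ->
    before (swap_time p q) p q && before (swap_time p q).+1 q p;
  swap_time_mod : forall t p q, before t p q -> before t.+1 q p ->
    t = swap_time p q %[mod half.*2];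
  swap_unique : forall t p q p' q', before t p q -> before t.+1 q p ->
    before t p' q' -> before t.+1 q' p' -> p = p' /\ q = q'
}.

Section AllowableSequence.
Variables (T : finType) (S : allowable_sequence T).
Implicit Types (A : {set T}) (t : nat) (p q r : T).

Local Notation M := (half S).
Local Notation b := (before S).

Definition swaps t p q := b t p q && b t.+1 q p.

(** When [p] and [q] swap, the line of projection is orthogonal to the line [pq],
    so the points projected before them are those on one fixed side of it. *)
Definition left p q r := b (swap_time S p q) r p.

Lemma before_neq t p q : b t p q -> p != q.
Proof. by apply: contraTneq => ->; rewrite before_irr. Qed.

Lemma before_asym t p q : b t p q -> b t q p = false.
Proof.
by move=> pq; apply/negbTE; rewrite -before_total // (before_neq pq).
Qed.

Lemma swaps_neq t p q : swaps t p q -> p != q.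
Proof. by case/andP=> /before_neq. Qed.

Lemma before_full t p q : b (t + M.*2) p q = b t p q.
Proof. by rewrite -addnn addnA !before_half. Qed.

Lemma before_mod t u p q : t = u %[mod M.*2] -> b t p q = b u p q.
Proof.
have E s : b (s %% M.*2) p q = b s p q.
  rewrite [in RHS](divn_eq s M.*2); elim: (s %/ _) => [|i IH].
    by rewrite mul0n add0n.
  by rewrite mulSn -addnA addnC before_full.
by move=> tu; rewrite -E tu E.
Qed.

Lemma left_swaps t p q r : swaps t p q -> left p q r = b t r p.
Proof.
by case/andP=> pq qp; apply: before_mod; rewrite -(swap_time_mod pq qp).
Qed.

Lemma swaps_half t p q : swaps (t + M) p q = swaps t q p.
Proof. by rewrite /swaps -addSn !before_half. Qed.

Lemma swaps_unchanged t p q :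
  ~~ swaps t p q -> ~~ swaps t q p -> b t.+1 p q = b t p q.
Proof.
have [->|pq] := eqVneq p q; first by rewrite !before_irr.
rewrite /swaps (before_total S t.+1 pq) (before_total S t pq).
by case: (b t q p); case: (b t.+1 q p).
Qed.

Lemma swaps_other t p q p' q' : swaps t p q ->
  (p', q') != (p, q) -> (p', q') != (q, p) -> b t.+1 p' q' = b t p' q'.
Proof.
move=> /andP[s1 s2] n1 n2; apply: swaps_unchanged; apply/negP => /andP[s3 s4].
  by have [E1 E2] := swap_unique s1 s2 s3 s4; rewrite E1 E2 eqxx in n1.
by have [E1 E2] := swap_unique s1 s2 s3 s4; rewrite E1 E2 eqxx in n2.
Qed.

(** A point between [p] and [q] would keep its place while they change order,
    against transitivity at the next time. *)
Lemma swaps_adjacent t p q r :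
  swaps t p q -> r != p -> r != q -> b t r p = b t r q.
Proof.
move=> spq rp rq; have pq := swaps_neq spq; have /andP[b1 b2] := spq.
apply/idP/idP => [rp'|rq']; first exact: before_trans b1.
rewrite before_total //; apply/negP => pr.
have: b t.+1 p q.
  apply: (@before_trans _ S _ r).
    by rewrite (swaps_other spq) // xpair_eqE ?(negbTE rp) ?(negbTE rq) ?andbF.
  by rewrite (swaps_other spq) // xpair_eqE ?(negbTE rp) ?(negbTE rq).
by rewrite (before_asym b2).
Qed.

Lemma exists_swaps p q : p != q -> exists t, swaps t p q.
Proof. by move=> /(swap_timeP S) pq; exists (swap_time S p q). Qed.

Lemma left_rev p q r :
  p != q -> r != p -> r != q -> left q p r = ~~ left p q r.
Proof.
move=> pq rp rq; have [t st] := exists_swaps pq.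
rewrite (left_swaps _ st) (swaps_adjacent st rp rq).
rewrite (@left_swaps (t + M)) ?swaps_half // before_half.
by rewrite before_total // eq_sym.
Qed.

Definition rank A t p := #|[set r in A | b t r p]|.

(** The first [k] points of [A]: a moving [k]-set, cut off by a half-plane. *)
Definition zone A k t := [set p in A | rank A t p < k].

(** The number of points of [A] to the left of the ordered pair; it is also the
    position at which the pair swaps ([ell_swaps]). *)
Definition ell A p q := #|[set r in A | left p q r]|.

Lemma ell_swaps A t p q : swaps t p q -> ell A p q = rank A t p.
Proof.
by move=> st; apply: eq_card => r; rewrite !inE (left_swaps _ st).
Qed.

Lemma rank_ltn_card A t p : p \in A -> rank A t p < #|A|.
Proof.
move=> pA; apply: proper_card; apply/properP; split.
  by apply/fintype.subsetP => r; rewrite inE => /andP[].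
by exists p; rewrite // inE before_irr andbF.
Qed.

Lemma rank_before A t p q : p \in A -> b t p q -> rank A t p < rank A t q.
Proof.
move=> pA pq; apply: proper_card; apply/properP; split.
  apply/fintype.subsetP => r; rewrite !inE => /andP[-> rp] /=.
  exact: before_trans pq.
by exists p; rewrite !inE ?pA ?pq // before_irr.
Qed.

Lemma before_rank A t p q :
  p \in A -> q \in A -> b t p q = (rank A t p < rank A t q).
Proof.
move=> pA qA; have [->|pq] := eqVneq p q; first by rewrite before_irr ltnn.
have [bpq|] := boolP (b t p q); first by rewrite (rank_before pA bpq).
rewrite before_total // negbK => /(rank_before qA).
by rewrite ltnNge => /negbTE; rewrite [in X in X -> _]leq_eqVlt => /norP[_ /negbTE->].
Qed.

Lemma rank_inj A t : {in A &, injective (rank A t)}.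
Proof.
move=> p q pA qA E; apply/eqP/negPn/negP => pq.
by have := before_total S t pq; rewrite !(before_rank t (A := A)) // E ltnn.
Qed.

Lemma exists_rank A t j : j < #|A| -> exists2 p, p \in A & rank A t p = j.
Proof.
move=> jA; pose I := [seq rank A t p | p <- enum A].
have uI : uniq I.
  rewrite map_inj_in_uniq ?enum_uniq // => p q.
  by rewrite !mem_enum; apply: rank_inj.
have sI : {subset I <= iota 0 #|A|}.
  move=> x /mapP[p]; rewrite mem_enum => pA ->.
  by rewrite mem_iota add0n rank_ltn_card.
have sz : size (iota 0 #|A|) <= size I by rewrite size_iota size_map -cardE.
have [_ E] := uniq_min_size uI sI sz.
have : j \in I by rewrite E mem_iota.
by case/mapP=> p; rewrite mem_enum => pA ->; exists p.
Qed.

(** Ranks are injective and below [#|A|], hence take every value once. *)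
Lemma card_zone A k t : k <= #|A| -> #|zone A k t| = k.
Proof.
move=> kA; pose I := [seq rank A t p | p <- enum (zone A k t)].
have uI : uniq I.
  rewrite map_inj_in_uniq ?enum_uniq // => p q.
  by rewrite !mem_enum !inE => /andP[pA _] /andP[qA _]; apply: rank_inj.
have : perm_eq I (iota 0 k).
  apply: uniq_perm; rewrite ?iota_uniq //.
  move=> j; rewrite mem_iota /= add0n; apply/mapP/idP => [[p]|jk].
    by rewrite mem_enum inE => /andP[_ +] ->.
  have [p pA pj] := exists_rank t (leq_trans jk kA).
  by exists p => //; rewrite mem_enum inE pA pj.
by move/perm_size; rewrite size_map size_iota -cardE.
Qed.

Lemma rank_swapsl A t p q : q \in A -> swaps t p q ->
  rank A t.+1 p = (rank A t p).+1.
Proof.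
move=> qA st; have pq := swaps_neq st; have /andP[b1 b2] := st.
rewrite /rank (cardsD1 q) inE qA b2 /= add1n; congr _.+1.
apply: eq_card => r; rewrite !inE; have [->|rq] /= := eqVneq r q.
  by rewrite (before_asym b1) andbF.
have [->|rp] := eqVneq r p; first by rewrite !before_irr.
by rewrite (swaps_other st) // xpair_eqE ?(negbTE rq) ?(negbTE rp).
Qed.

Lemma rank_swapsr A t p q : p \in A -> swaps t p q ->
  rank A t q = (rank A t.+1 q).+1.
Proof.
move=> pA st; have pq := swaps_neq st; have /andP[b1 b2] := st.
rewrite /rank (cardsD1 p) inE pA b1 /= add1n; congr _.+1.
apply: eq_card => r; rewrite !inE; have [->|rp] /= := eqVneq r p.
  by rewrite (before_asym b2) andbF.
have [->|rq] := eqVneq r q; first by rewrite !before_irr.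
by rewrite (swaps_other st) // xpair_eqE ?(negbTE rq) ?(negbTE rp).
Qed.

Lemma rank_swaps A t p q : p \in A -> q \in A -> swaps t p q ->
  rank A t q = (rank A t p).+1.
Proof.
move=> pA qA st; have pq := swaps_neq st; have /andP[b1 b2] := st.
rewrite /rank (cardsD1 p) inE pA b1 /= add1n; congr _.+1.
apply: eq_card => r; rewrite !inE; have [->|rp] /= := eqVneq r p.
  by rewrite before_irr andbF.
have [->|rq] := eqVneq r q; first by rewrite before_irr (before_asym b1).
by rewrite (swaps_adjacent st).
Qed.

Lemma rank_step A t p :
  [\/ rank A t.+1 p = rank A t p,
      exists2 q, q \in A & swaps t p q | exists2 q, q \in A & swaps t q p].
Proof.
have [/exists_inP[q qA s]|n1] := boolP [exists q in A, swaps t p q].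
  by constructor 2; exists q.
have [/exists_inP[q qA s]|n2] := boolP [exists q in A, swaps t q p].
  by constructor 3; exists q.
constructor 1; apply: eq_card => r; rewrite !inE; have [rA|//] := boolP (r \in A).
move: n1 n2; rewrite !negb_exists_in => /forall_inP/(_ r rA) n1.
by move=> /forall_inP/(_ r rA) n2; rewrite swaps_unchanged.
Qed.

(** Half a turn later the points before and after [p] are exchanged. *)
Lemma rank_half A t p : p \in A -> (rank A (t + M) p + rank A t p).+1 = #|A|.
Proof.
move=> pA; rewrite (cardsD1 p) pA add1n; congr _.+1.
rewrite -(cardsID [set r in A | b t r p] (A :\ p)) addnC; congr (_ + _).
  apply: eq_card => r; rewrite !inE; have [->|rp] := eqVneq r p.
    by rewrite before_irr andbF.
  by case: (r \in A).
apply: eq_card => r; rewrite !inE before_half; have [->|rp] := eqVneq r p.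
  by rewrite before_irr andbF.
rewrite before_total 1?eq_sym //=; by case: (r \in A); case: (b t r p).
Qed.

Lemma ell_rev A p q : p \in A -> q \in A -> p != q ->
  (ell A p q + ell A q p).+2 = #|A|.
Proof.
move=> pA qA pq; have [t st] := exists_swaps pq.
rewrite (ell_swaps _ st) (@ell_swaps _ (t + M) q p) ?swaps_half //.
by rewrite -(@rank_half _ t q) // (rank_swaps pA qA st) addnS addnC.
Qed.

Lemma exit_zone A t p k : rank A t p < k <= rank A t.+1 p ->
  exists q, [/\ q \in A, swaps t p q & (rank A t p).+1 = k].
Proof.
case: (rank_step A t p) => [->|[q qA st]|[q qA st]].
- by case/andP=> /leq_trans h /h; rewrite ltnn.
- rewrite (rank_swapsl qA st) => /andP[h1 h2]; exists q; split=> //.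
  by apply/eqP; rewrite eqn_leq h1 h2.
- by rewrite (rank_swapsr qA st); lia.
Qed.

End AllowableSequence.

(** * Extreme points *)

Section Peeling.
Variables (T : finType) (S : allowable_sequence T) (A : {set T}).
Implicit Types (t k j : nat) (p q r v : T).

Local Notation M := (half S).
Local Notation b := (before S).
Local Notation rk := (rank S A).
Local Notation Z := (zone S A).
Local Notation n := #|A|.

Lemma rank_mod t u p : t = u %[mod M.*2] -> rk t p = rk u p.
Proof. by move=> tu; apply: eq_card => r; rewrite !inE (before_mod _ _ tu). Qed.

Lemma rank_full t p : rk (t + M.*2) p = rk t p.
Proof. by apply: rank_mod; rewrite modnDr. Qed.

Lemma zone_full k t : Z k (t + M.*2) = Z k t.
Proof. by apply/setP => p; rewrite !inE rank_full. Qed.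

Lemma first_before t v q :
  rk t v = 0 -> q \in A -> q != v -> b t v q.
Proof.
move=> /eqP; rewrite cards_eq0 => /eqP/setP/(_ q); rewrite !inE => + qA qv.
by rewrite qA /= before_total // => /negbFE.
Qed.

(** During the half-turn after being first, an extreme point only moves back. *)
Lemma first_leave t0 v t t' q : rk t0 v = 0 -> q \in A ->
  t0 <= t <= t' -> t' <= t0 + M -> b t q v -> b t' q v.
Proof.
move=> v0 qA /andP[h1 h2] h3 bq; apply: (@before_convex _ S t t' (t0 + M)) => //.
- by rewrite h2 h3.
- by rewrite leq_add2r.
- by rewrite before_half; apply: first_before => //; apply: before_neq bq.
Qed.

(** During the second half-turn it only moves forward. *)
Lemma first_return t0 v t t' q : rk t0 v = 0 -> q \in A ->
  t0 + M <= t <= t' -> t' <= t0 + M.*2 -> b t v q -> b t' v q.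
Proof.
move=> v0 qA /andP[h1 h2] h3 bq.
apply: (@before_convex _ S t t' (t0 + M.*2)) => //.
- by rewrite h2 h3.
- by rewrite -addnn addnA leq_add2r.
- rewrite before_full; apply: first_before => //.
  by rewrite eq_sym; apply: before_neq bq.
Qed.

Lemma rank_leave t0 v t t' : rk t0 v = 0 ->
  t0 <= t <= t' -> t' <= t0 + M -> rk t v <= rk t' v.
Proof.
move=> v0 h1 h2; apply/subset_leq_card/fintype.subsetP => q; rewrite !inE.
by case/andP=> qA bq; rewrite qA (first_leave v0 qA h1).
Qed.

Lemma rank_return t0 v t t' : rk t0 v = 0 ->
  t0 + M <= t <= t' -> t' <= t0 + M.*2 -> rk t' v <= rk t v.
Proof.
move=> v0 h1 h2; apply/subset_leq_card/fintype.subsetP => q; rewrite !inE.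
case/andP=> qA bq; rewrite qA /= before_total ?(before_neq bq) //.
by apply/negP => /(first_return v0 qA h1 h2); rewrite (before_asym bq).
Qed.

Lemma rank_last t0 v : v \in A -> rk t0 v = 0 -> rk (t0 + M) v = n.-1.
Proof. by move=> vA v0; rewrite -(rank_half S t0 vA) v0 addn0. Qed.

(** An extreme point travels from the first position to the last in half a turn,
    so it passes each gap, and the swap at gap [j] is a pair with [j] points on its
    left. *)
Lemma first_exits t0 v j : v \in A -> rk t0 v = 0 -> j.+1 < n ->
  exists q, [/\ q \in A, q != v & ell S A v q = j].
Proof.
move=> vA v0 jn; have ex : exists d, j < rk (t0 + d) v.
  by exists M; rewrite rank_last //; lia.
case: (ex_minnP ex) => -[|d]; first by rewrite addn0 v0.
move=> jd /(_ d)/contraNN; rewrite ltnn -leqNgt => /(_ isT) dj.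
have [|q [qA st rkj]] := @exit_zone _ S A (t0 + d) v j.+1.
  by rewrite -addnS jd andbT; lia.
exists q; split=> //; first by rewrite eq_sym (swaps_neq st).
by rewrite (ell_swaps _ st); lia.
Qed.

Lemma card_first_exits t0 v m : v \in A -> rk t0 v = 0 -> m.+1 < n ->
  m < #|[set q in A :\ v | ell S A v q <= m]|.
Proof.
move=> vA v0 mn; pose J := [seq ell S A v q | q <- enum [set q in A :\ v | ell S A v q <= m]].
have : size (iota 0 m.+1) <= size J.
  apply: uniq_leq_size; first exact: iota_uniq.
  move=> j; rewrite mem_iota add0n => /= jm.
  have [|q [qA qv qj]] := @first_exits t0 v j vA v0; first by lia.
  by apply/mapP; exists q => //; rewrite mem_enum !inE qv qA qj -ltnS jm.
by rewrite size_iota size_map -cardE.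
Qed.

Lemma card_last_exits t0 v m : v \in A -> rk t0 v = 0 -> m < n ->
  m <= #|[set q in A :\ v | ell S A q v < m]|.
Proof.
move=> vA v0 mn; pose J := [seq ell S A q v | q <- enum [set q in A :\ v | ell S A q v < m]].
have : size (iota 0 m) <= size J.
  apply: uniq_leq_size; first exact: iota_uniq.
  move=> j; rewrite mem_iota add0n => /= jm.
  have [|q [qA qv qj]] := @first_exits t0 v (n.-2 - j) vA v0; first by lia.
  have E : ell S A q v = j by have := ell_rev S qA vA qv; lia.
  by apply/mapP; exists q => //; rewrite mem_enum !inE qv qA E.
by rewrite size_iota size_map -cardE.
Qed.

(** An extreme point is in the first [k] positions during a single stretch of each
    turn: it leaves at [f] and is back at [s], and the stretch outside lasts more
    than half a turn.  Just outside, it has exactly the [k] points of the zone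
    before it, and none of those before it at [f] can be before it again at
    [s.-1]: each has swapped with it once in between. *)
Lemma extreme_stay t0 v k : v \in A -> rk t0 v = 0 -> 0 < k -> k.*2 < n ->
  exists f s, [/\ t0 < f <= t0 + M, f + M < s <= t0 + M.*2,
    [/\ forall t, t0 <= t < f -> v \in Z k t,
       forall t, f <= t < s -> v \notin Z k t &
       forall t, s <= t <= t0 + M.*2 -> v \in Z k t] &
    [disjoint Z k f & Z k s.-1]].
Proof.
move=> vA v0 k0 kn.
have inZ t : (v \in Z k t) = (rk t v < k) by rewrite inE vA.
have rlast := rank_last vA v0.
have ex : exists d, v \notin Z k (t0 + d).
  by exists M; rewrite inZ rlast; lia.
case: (ex_minnP ex) => d vd dmin.
have dM : d <= M by apply: dmin; rewrite inZ rlast; lia.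
have d0 : 0 < d by case: (posnP d) vd => // ->; rewrite addn0 inZ v0 k0.
have before_d t : t0 <= t < t0 + d -> v \in Z k t.
  move=> /andP[h1 h2]; apply: contraT => h.
  by have := dmin (t - t0); rewrite subnKC // => /(_ h); lia.
have rd : rk (t0 + d) v = k.
  have [|q [qA st rkj]] := @exit_zone _ S A (t0 + d.-1) v k.
    rewrite -addnS prednK //; rewrite inZ -leqNgt in vd; rewrite vd andbT.
    by rewrite -inZ before_d //; lia.
  by rewrite -(prednK d0) addnS (rank_swapsl qA st).
have rdM : rk (t0 + d + M) v = n.-1 - k.
  by have := rank_half S (t0 + d) vA; rewrite rd; lia.
have ex2 : exists e, v \in Z k (t0 + d + M + e).
  exists (M - d); have -> : t0 + d + M + (M - d) = t0 + M.*2 by lia.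
  by rewrite inZ rank_full v0.
case: (ex_minnP ex2) => e ve emin.
have e0 : 0 < e by case: (posnP e) ve => // ->; rewrite addn0 inZ rdM; lia.
have eM : e <= M - d.
  apply: emin; have -> : t0 + d + M + (M - d) = t0 + M.*2 by lia.
  by rewrite inZ rank_full v0.
have out t : t0 + d <= t < t0 + d + M + e -> v \notin Z k t.
  move=> /andP[h1 h2]; rewrite inZ -leqNgt.
  have [tM|tM] := leqP t (t0 + M).
    by rewrite -rd; apply: (@rank_leave t0) => //; lia.
  have [tM2|tM2] := leqP t (t0 + d + M).
    apply: (@leq_trans (n.-1 - k)); first by lia.
    by rewrite -rdM; apply: (@rank_return t0) => //; lia.
  rewrite leqNgt -inZ; apply/negP => h.
  by have := emin (t - (t0 + d + M)); rewrite subnKC ?(ltnW tM2) // => /(_ h); lia.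
exists (t0 + d), (t0 + d + M + e); split; first by lia.
- by lia.
- split=> // t /andP[h1 h2]; rewrite inZ.
  apply: leq_ltn_trans (_ : rk (t0 + d + M + e) v < k); last by rewrite -inZ.
  by apply: (@rank_return t0) => //; lia.
have rs : rk (t0 + d + M + e).-1 v = k.
  have h : k <= rk (t0 + d + M + e).-1 v.
    by rewrite leqNgt -inZ out //; lia.
  have := rank_step S A (t0 + d + M + e).-1 v; rewrite prednK; last by lia.
  move: ve; rewrite inZ => ve [E|[q qA st]|[q qA st]].
  - by lia.
  - by have := rank_swapsl qA st; rewrite prednK; lia.
  - by have := rank_swapsr qA st; rewrite prednK; lia.
apply/pred0P => q /=; apply/negbTE/negP => /andP[]; rewrite !inE => /andP[qA q1] /andP[_ q2].
have bq1 : b (t0 + d) q v by rewrite (before_rank S _ qA vA) rd.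
have bq2 : b (t0 + d + M + e).-1 q v by rewrite (before_rank S _ qA vA) rs.
have : b (t0 + d + M + e).-1 v q.
  apply: (@first_return t0 _ (t0 + d + M)) => //; [by lia|by lia|].
  by rewrite before_half.
by rewrite (before_asym bq2).
Qed.

End Peeling.

(** * Three extreme points to delete *)

Lemma eqmod_window d f t u :
  t = u %[mod d] -> f <= t < f + d -> f <= u < f + d -> t = u.
Proof.
move=> tu ht hu; wlog le : t u tu ht hu / u <= t.
  by move=> W; have [/W->|/ltnW/W->] := leqP u t.
have : d %| t - u by rewrite -eqn_mod_dvd //; apply/eqP.
case: (posnP (t - u)) => [|pos /(dvdn_leq pos)]; lia.
Qed.

Lemma exists_window d f t : 0 < d -> exists2 u, f <= u < f + d & u = t %[mod d].
Proof.
move=> d0; exists (f + (t + (d - f %% d)) %% d).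
  by rewrite leq_addr ltn_add2l ltn_mod.
rewrite modnDmr addnCA -modnDmr -[(f + _) %% d]modnDml subnKC ?modnn ?addn0 //.
by rewrite ltnW ?ltn_mod.
Qed.

Lemma card_disjoint3 (I : finType) (X Y W B : {set I}) :
  [disjoint X & Y] -> [disjoint Y & W] -> [disjoint W & X] ->
  X \subset B -> Y \subset B -> W \subset B -> #|X| + #|Y| + #|W| <= #|B|.
Proof.
move=> XY YW WX XB YB WB.
have -> : #|X| + #|Y| + #|W| = #|(X :|: Y) :|: W|.
  rewrite [RHS]cardsU cardsU (finset.disjoint_setI0 XY) cards0 subn0.
  suff -> : (X :|: Y) :&: W = finset.set0 by rewrite cards0 subn0.
  by rewrite finset.setIUl (finset.disjoint_setI0 YW) [X :&: W]finset.setIC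
    (finset.disjoint_setI0 WX) finset.setU0.
by apply: subset_leq_card; rewrite !finset.subUset XB YB WB.
Qed.

Section Triple.
Variables (T : finType) (S : allowable_sequence T) (A : {set T}).
Implicit Types (t k j : nat) (p q r v : T) (Q : {set T}).

Local Notation M := (half S).
Local Notation b := (before S).
Local Notation rk := (rank S A).
Local Notation Z := (zone S A).
Local Notation n := #|A|.

(** The additional pairs gained when [Q] is deleted: they have [j] points of [A] on
    the left, and at least [j - 1] points of [A :\: Q].  The second point may belong
    to [Q]; such pairs are left out when those meeting [Q] are counted. *)
Definition light Q j := [set x : T * T | [&& x.1 \in A :\: Q, x.2 \in A,
  x.1 != x.2, ell S A x.1 x.2 == j & #|[set r in Q | left S x.1 x.2 r]| <= 1]].

Definition light_in Q j lo hi := [set x in light Q j |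
  [exists i : 'I_hi, (lo <= i) && swaps S i x.1 x.2]].

Lemma light_in_disjoint Q j f lo hi lo' hi' :
  f <= lo -> hi <= lo' -> hi' <= f + M.*2 ->
  [disjoint light_in Q j lo hi & light_in Q j lo' hi'].
Proof.
move=> h1 h2 h3; apply/pred0P => x /=; apply/negbTE/negP => /andP[].
rewrite !inE => /andP[_ /existsP[[t ht] /= /andP[lt /andP[s1 s2]]]].
case/andP=> _ /existsP[[u hu] /= /andP[lu /andP[s3 s4]]].
suff : t = u by lia.
apply: (@eqmod_window M.*2 f); [|lia|lia].
by rewrite (swap_time_mod s1 s2) (swap_time_mod s3 s4).
Qed.

(** The [k] points of the zone at time [lo] are either in the zone at time [hi], or
    leave it in between.  A departure takes place at the border of the zone, so it
    is a swap with [k - 1] points on the left, all of them in the zone; hence it is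
    light as soon as the zone never holds two points of [Q].  One departure is lost
    to the point of [Q] that may itself be in the zone. *)
Lemma card_light_in Q k lo hi : Q \subset A -> 0 < k <= n -> lo <= hi ->
  (forall t, lo <= t <= hi -> #|Q :&: Z k t| <= 1) ->
  k <= #|Z k lo :&: Z k hi| + #|light_in Q k.-1 lo hi| + 1.
Proof.
move=> QA /andP[k0 kn] lohi few.
have H : #|(Z k lo :\: Z k hi) :\: Q| <= #|light_in Q k.-1 lo hi|.
  have I := leq_imset_card (@fst T T) (light_in Q k.-1 lo hi).
  apply: leq_trans I.
  apply/subset_leq_card/fintype.subsetP => p.
  rewrite !finset.in_setD => /and3P[pQ pout pin].
  have pA : p \in A by move: pin; rewrite inE => /andP[].
  have ex : exists d, p \notin Z k (lo + d) by exists (hi - lo); rewrite subnKC.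
  case: (ex_minnP ex) => d pd dmin.
  have dhi : d <= hi - lo by apply: dmin; rewrite subnKC.
  have d0 : 0 < d by case: (posnP d) pd => // ->; rewrite addn0 pin.
  have [|q [qA st rkj]] := @exit_zone _ S A (lo + d.-1) p k.
    have : p \in Z k (lo + d.-1) by apply: contraT => /dmin; lia.
    by move: pd; rewrite -addnS prednK // !inE pA /= -leqNgt => -> ->.
  apply/imsetP; exists (p, q) => //; rewrite !inE /= pQ pA qA (swaps_neq st) /=.
  rewrite (ell_swaps _ st) -rkj eqxx /=; apply/andP; split.
    apply: leq_trans (few (lo + d.-1) _); last by lia.
    apply/subset_leq_card/fintype.subsetP => r; rewrite !inE => /andP[rQ rl].
    have rA := fintype.subsetP QA r rQ; rewrite rQ rA /=.
    rewrite (left_swaps _ st) in rl; apply: ltn_trans (rank_before rA rl) _.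
    by rewrite -rkj.
  have lt : lo + d.-1 < hi by lia.
  by apply/existsP; exists (Ordinal lt) => /=; rewrite st leq_addr.
have F := few lo; rewrite leqnn lohi in F; have {}F := F isT.
have := cardsID (Z k hi) (Z k lo); rewrite card_zone //.
have := cardsID Q (Z k lo :\: Z k hi).
have : #|(Z k lo :\: Z k hi) :&: Q| <= #|Q :&: Z k lo|.
  by apply/subset_leq_card/fintype.subsetP => r; rewrite !inE => /andP[/andP[_ ->] ->].
lia.
Qed.

Lemma few_of_three (a c e : T) (B : {set T}) :
  a \notin B -> c \notin B -> #|[set a; c; e] :&: B| <= 1.
Proof.
move=> aB cB; rewrite -(cards1 e); apply/subset_leq_card/fintype.subsetP => r.
rewrite !inE => /andP[/orP[/orP[]|] /eqP-> //]; first by rewrite (negbTE aB).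
by rewrite (negbTE cB).
Qed.

(** The three points are an arbitrary extreme point [a], and the two consecutive
    extreme points [e] and [c] such that, when [a] leaves the zone, [e] is in it and
    [c] is not.  So [c] enters after [a] has left, and as stays in the zone last less
    than half a turn, they have no common time later in the turn either. *)
Lemma exists_peeling_triple k : 1 < k -> k.*2 < n ->
  exists Q : {set T}, [/\ Q \subset A, #|Q| = 3,
    forall v, v \in Q -> exists t, rk t v = 0,
    forall t, ~~ (Q \subset Z k t) &
    3 * k <= #|light Q k.-1| + n + 3].
Proof.
move=> k1 kn; have k0 : 0 < k by apply: ltnW.
have inZ t v : v \in A -> (v \in Z k t) = (rk t v < k) by move=> vA; rewrite inE vA.
have n0 : 0 < n by apply: leq_ltn_trans kn.
have half_out v t : v \in A -> v \in Z k t -> v \notin Z k (t + M).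
  move=> vA; rewrite !inZ //; have := rank_half S t vA; clear -kn; lia.
have [a aA a0] := exists_rank S 0 n0.
have [fa [sa [/andP[fa1 fa2] /andP[sa1 sa2] [za1 za2 za3] da]]] :=
  extreme_stay aA a0 k0 kn.
have afa : a \notin Z k fa by apply: za2; clear -sa1; lia.
have [d dA dlast] : exists2 d, d \in A & rk (fa + M) d = 0 by apply: exists_rank.
pose P t := (fa <= t) && [exists v in A, (rk t v == 0) && (v \notin Z k fa)].
have PM : P (fa + M).
  rewrite /P leq_addr; apply/exists_inP; exists d => //.
  rewrite dlast eqxx inZ //=; have := rank_half S fa dA.
  by rewrite dlast; clear -kn; lia.
have exP : exists t, P t by exists (fa + M).
case: (ex_minnP exP) => tc /andP[fatc /exists_inP[c cA /andP[/eqP c0 cfa]]] tcmin.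
have tcM := tcmin _ PM.
have ltc : fa < tc.
  rewrite ltn_neqAle fatc andbT; apply: contraNneq cfa => ->.
  by rewrite inZ // c0.
have [e eA e0] : exists2 e, e \in A & rk tc.-1 e = 0 by apply: exists_rank.
have efa : e \in Z k fa.
  apply: contraT => h; have := tcmin tc.-1; rewrite /P.
  have -> : fa <= tc.-1 by clear -ltc; lia.
  have -> : [exists v in A, (rk tc.-1 v == 0) && (v \notin Z k fa)].
    by apply/exists_inP; exists e => //; rewrite e0 eqxx h.
  by move=> /(_ isT); clear -ltc; lia.
clear PM exP tcmin P dlast dA d.
have [fe [se [/andP[fe1 fe2] /andP[se1 se2] [ze1 ze2 ze3] de]]] :=
  extreme_stay eA e0 k0 kn.
have [fc [sc [/andP[fc1 fc2] /andP[sc1 sc2] [zc1 zc2 zc3] dc]]] :=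
  extreme_stay cA c0 k0 kn.
(* The stays of [e], [a], [c] in the zone, in the order of the rotation: [e] is in it
from [se - 2 M] to [fe], [c] from [sc - 2 M] to [fc], and [a] again from [sa] on. *)
have se_le : se <= fa + M.*2.
  rewrite leqNgt; apply/negP => h; have := ze2 (fa + M.*2).
  rewrite zone_full efa => /(_ _)/negP H; apply: H => //.
  by clear -h fe2 tcM ltc; lia.
have sc_gt : fa + M.*2 < sc.
  rewrite ltnNge; apply/negP => h; have := zc3 (fa + M.*2).
  rewrite zone_full (negbTE cfa) => H; suff: false by [].
  by apply: H; clear -h ltc; lia.
have fe_lt : fe < sa.
  apply: leq_ltn_trans (_ : fe <= fa + M) sa1.
  rewrite leqNgt; apply/negP => h; have := half_out e fa eA efa.
  by rewrite ze1 //; clear -h tcM ltc; lia.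
have fc_lt : fc < se by clear -fc2 se1 fe1 ltc; lia.
have ae : a != e by apply: contraNneq afa => ->.
have ec : e != c by apply: contraNneq cfa => <-.
have ac : a != c.
  apply/eqP => Eac; have := za2 tc; rewrite {1}Eac inZ // c0 k0.
  move=> /(_ _)/negP H; apply: H => //.
  by clear -ltc tcM sa1; lia.
pose Q := [set a; e; c].
have QA : Q \subset A.
  by apply/fintype.subsetP => v; rewrite !inE => /orP[/orP[]|] /eqP->.
exists Q; split=> //.
- by rewrite /Q -finset.setUA cardsU1 cards2 !inE negb_or ae ac ec.
- move=> v; rewrite !inE => /orP[/orP[]|] /eqP->;
    [by exists 0 | by exists tc.-1 | by exists tc].
- move=> t; apply/negP => /fintype.subsetP QZ.
  have [|u /andP[hu1 hu2] tu] := @exists_window M.*2 fa t.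
    by clear -fa1 fa2; lia.
  have {}QZ v : v \in Q -> v \in Z k u.
    move=> vQ; have vA := fintype.subsetP QA v vQ.
    by have := QZ v vQ; rewrite !inZ // (@rank_mod _ S A _ _ v tu).
  have [Qa Qe Qc] : [/\ a \in Q, e \in Q & c \in Q].
    by rewrite !inE !eqxx !orbT.
  have := QZ a Qa; have := QZ e Qe; have := QZ c Qc.
  have [h1|h1] := ltnP u sa; first by rewrite (negbTE (za2 u _)) // hu1 h1.
  have [h2|h2] := ltnP u se.
    by rewrite (negbTE (ze2 u _)) // h2 andbT; clear -h1 fe_lt; lia.
  by rewrite (negbTE (zc2 u _)) //; clear -h2 fc_lt hu2 sc_gt; lia.
have kn' : 0 < k <= n by rewrite k0; clear -kn; lia.
have sub_light j lo hi : light_in Q j lo hi \subset light Q j.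
  by apply/fintype.subsetP => x; rewrite inE => /andP[].
have QaC : Q = [set e; c; a] by rewrite /Q -finset.setUA finset.setUC.
have QeC : Q = [set a; c; e] by rewrite /Q finset.setUAC.
have [gap|nogap] := ltnP fc sa.
(* If [c] leaves before [a] is back, then from [fe] to [se] the zone holds at most one
of the three, and it is entirely renewed; this gives [k >= 3 k - n] light pairs. *)
- have := @card_light_in Q k fe se.-1 QA kn'.
  have -> : fe <= se.-1 by clear -se1; lia.
  have few t : fe <= t <= se.-1 -> #|Q :&: Z k t| <= 1.
    move=> /andP[h1 h2]; have eo : e \notin Z k t.
      by apply: ze2; clear -h1 h2 se1; lia.
    have [h|h] := ltnP t sa.
      by apply: few_of_three => //; apply: za2; clear -h h1 fe1 ltc; lia.
    rewrite QaC; apply: few_of_three => //; apply: zc2.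
    by clear -h gap h2 se_le sc_gt; lia.
  move=> /(_ isT few); rewrite finset.disjoint_setI0 // cards0.
  have := subset_leq_card (sub_light k.-1 fe se.-1).
  by clear -kn; lia.
have E1 := @card_light_in Q k fa (sc.-1 - M.*2) QA kn'.
have E2 := @card_light_in Q k fe sa.-1 QA kn'.
have E3 := @card_light_in Q k fc se.-1 QA kn'.
have {}E1 : k <= #|Z k fa :&: Z k sc.-1| + #|light_in Q k.-1 fa (sc.-1 - M.*2)| + 1.
  rewrite -(subnK (_ : M.*2 <= sc.-1)) ?zone_full; last by clear -sc_gt; lia.
  rewrite addnK; apply: E1; first by clear -sc_gt; lia.
  move=> t /andP[h1 h2]; rewrite QeC; apply: few_of_three.
    by apply: za2; rewrite h1; clear -h2 sc2 tcM sa1 fa1; lia.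
  by rewrite -zone_full; apply: zc2; clear -h1 h2 sc_gt fc2 tcM; lia.
have {}E2 : k <= #|Z k fe :&: Z k sa.-1| + #|light_in Q k.-1 fe sa.-1| + 1.
  apply: E2 => [|t /andP[h1 h2]]; first by clear -fe_lt; lia.
  apply: few_of_three; [apply: za2; clear -h1 h2 fe1 ltc fe_lt|
    apply: ze2; clear -h1 h2 nogap fc_lt fe_lt]; lia.
have {}E3 : k <= #|Z k fc :&: Z k se.-1| + #|light_in Q k.-1 fc se.-1| + 1.
  apply: E3 => [|t /andP[h1 h2]]; first by clear -fc_lt; lia.
  rewrite QaC; apply: few_of_three; [apply: ze2; clear -h1 h2 fc_lt nogap fe_lt|
    apply: zc2; clear -h1 h2 se_le sc_gt fc_lt]; lia.
have D12 : [disjoint light_in Q k.-1 fa (sc.-1 - M.*2) & light_in Q k.-1 fe sa.-1].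
  by apply: (@light_in_disjoint _ _ fa); clear -fe1 ltc sc2 sa2 fa1; lia.
have D13 : [disjoint light_in Q k.-1 fa (sc.-1 - M.*2) & light_in Q k.-1 fc se.-1].
  by apply: (@light_in_disjoint _ _ fa); clear -fc1 ltc sc2 se_le; lia.
have D23 : [disjoint light_in Q k.-1 fe sa.-1 & light_in Q k.-1 fc se.-1].
  by apply: (@light_in_disjoint _ _ fa); clear -fe1 ltc nogap se_le; lia.
have L : #|light_in Q k.-1 fa (sc.-1 - M.*2)| + #|light_in Q k.-1 fe sa.-1| +
         #|light_in Q k.-1 fc se.-1| <= #|light Q k.-1|.
  by apply: card_disjoint3; rewrite ?sub_light // disjoint_sym.
(* The disjointness of zones seen from [a], [c] and [e] in turn. *)
have Zsum : #|Z k fa :&: Z k sc.-1| + #|Z k fe :&: Z k sa.-1| +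
            #|Z k fc :&: Z k se.-1| <= n.
  have sI (X Y X' Y' : {set T}) : [disjoint X & Y'] -> [disjoint X :&: Y & X' :&: Y'].
    by apply: disjointW; [exact: finset.subsetIl | exact: finset.subsetIr].
  have D1 : [disjoint Z k fa :&: Z k sc.-1 & Z k fe :&: Z k sa.-1] by exact: sI.
  have D2 : [disjoint Z k fc :&: Z k se.-1 & Z k fa :&: Z k sc.-1] by exact: sI.
  have D3 : [disjoint Z k fe :&: Z k sa.-1 & Z k fc :&: Z k se.-1] by exact: sI.
  have ZA t : Z k t \subset A by apply/fintype.subsetP => v; rewrite inE => /andP[].
  have IA X t : Z k t :&: X \subset A.
    by apply: fintype.subset_trans (ZA t); apply: finset.subsetIl.
  by apply: card_disjoint3.
by clear -E1 E2 E3 L Zsum; lia.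
Qed.

End Triple.

(** * Pairs with few points on their left *)

Lemma card_pairs (I J : finType) (Q : {set I}) (P : I -> J -> bool) :
  #|[set x : I * J | (x.1 \in Q) && P x.1 x.2]| = \sum_(v in Q) #|[set q | P v q]|.
Proof.
rewrite -sum1_card; under [RHS]eq_bigr do rewrite -sum1_card.
rewrite (pair_big_dep (mem Q) (fun v q => q \in [set q | P v q])) /=.
by apply: eq_bigl => x; rewrite !inE.
Qed.

Lemma card_pairs_sym (I : finType) (Q : {set I}) (P : rel I) :
  #|[set x : I * I | (x.2 \in Q) && P x.1 x.2]| = \sum_(v in Q) #|[set q | P q v]|.
Proof.
rewrite -(card_pairs _ (fun v q => P q v)).
rewrite -!sum1_card (reindex_inj (h := fun x : I * I => (x.2, x.1))) /=.
  by apply: eq_bigl => x; rewrite !inE.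
by move=> [p q] [p' q'] [-> ->].
Qed.

Section Levels.
Variables (T : finType) (S : allowable_sequence T).
Implicit Types (A Q : {set T}).

Definition pairs_le A m := [set x : T * T |
  [&& x.1 \in A, x.2 \in A, x.1 != x.2 & ell S A x.1 x.2 <= m]].

Lemma ell_setD A Q p q : Q \subset A ->
  ell S A p q = ell S (A :\: Q) p q + #|[set r in Q | left S p q r]|.
Proof.
move=> QA; rewrite /ell -(cardsID Q [set r in A | _]) addnC.
congr (_ + _); apply: eq_card => r; rewrite !inE; first by rewrite andbA.
by case: (boolP (r \in Q)) => [/(fintype.subsetP QA)->|]; rewrite ?andbT ?andbF.
Qed.

(** Four disjoint kinds of pairs with at most [m] points on the left are counted:
    those starting in [Q], those ending in [Q] with fewer than [m] points on the
    left, the light ones, and those off [Q] with at most [m - 2] points of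
    [A :\: Q] on the left.  The latter have at most two points of [Q] on the left,
    since a zone never contains [Q]. *)
Lemma pairs_le_peel A m : 1 < m -> m.+1.*2 < #|A| ->
  exists Q : {set T}, [/\ Q \subset A, #|Q| = 3 &
    #|pairs_le (A :\: Q) (m - 2)| + 6 * m + (3 * m - #|A|)
      <= #|pairs_le A m| + 9].
Proof.
move=> m1 mn.
have [Q [QA Q3 first thin few]] := exists_peeling_triple S (ltnW m1 : 1 < m.+1) mn.
exists Q; split=> //.
have inA v : v \in Q -> v \in A by apply: (fintype.subsetP QA).
pose X1 := [set x : T * T | x.1 \in Q].
pose X2 := [set x : T * T | x.2 \in Q].
pose V := pairs_le A m.
have split : #|V| = #|V :&: X1| + #|(V :\: X1) :&: light S A Q m|
    + #|(V :\: X1 :\: light S A Q m) :&: X2|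
    + #|(V :\: X1 :\: light S A Q m) :\: X2|.
  rewrite -(cardsID X1 V) -(cardsID (light S A Q m) (V :\: X1)).
  by rewrite -(cardsID X2 (V :\: X1 :\: light S A Q m)) !addnA.
have S1 : 3 * m.-1 <= #|V :&: X1|.
  apply: (@leq_trans #|[set x : T * T | (x.1 \in Q) &&
      [&& x.2 \in A :\: Q & ell S A x.1 x.2 <= m]]|); last first.
    apply/subset_leq_card/fintype.subsetP => -[p q]; rewrite !inE /=.
    move=> /and3P[pQ /andP[qQ qA] ->]; rewrite pQ qA inA //= andbT.
    by rewrite andbT; apply: contraNneq qQ => <-.
  rewrite (card_pairs Q (fun p q => (q \in A :\: Q) && (ell S A p q <= m))).
  rewrite -[3]Q3 -sum_nat_const; apply: leq_sum => v vQ.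
  have [t vt] := first v vQ.
  have := card_first_exits (inA v vQ) vt (_ : m.+1 < #|A|).
  have -> : m.+1 < #|A| by clear -mn; lia.
  move=> /(_ isT); rewrite -(cardsID Q).
  have : #|[set q in A :\ v | ell S A v q <= m] :&: Q| <= #|Q :\ v|.
    apply/subset_leq_card/fintype.subsetP => q; rewrite !inE.
    by move=> /andP[/andP[/andP[-> _] _] ->].
  have := cardsD1 v Q; rewrite vQ Q3.
  have : #|[set q in A :\ v | ell S A v q <= m] :\: Q| <=
         #|[set q | (q \in A :\: Q) && (ell S A v q <= m)]|.
    apply/subset_leq_card/fintype.subsetP => q; rewrite !inE.
    by move=> /andP[-> /andP[/andP[_ ->] ->]].
  by clear; lia.
have S2 : 3 * (m - 2) <= #|(V :\: X1 :\: light S A Q m) :&: X2|.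
  apply: (@leq_trans #|[set x : T * T | (x.2 \in Q) &&
      [&& x.1 \in A :\: Q & ell S A x.1 x.2 < m]]|); last first.
    apply/subset_leq_card/fintype.subsetP => -[p q]; rewrite !inE /=.
    move=> /and3P[qQ /andP[pQ pA] lm]; rewrite qQ pQ pA inA // (ltnW lm) !andbT /=.
    rewrite (ltn_eqF lm) /= !andbF /=.
    by apply: contraNneq pQ => ->.
  rewrite (card_pairs_sym Q (fun p q => (p \in A :\: Q) && (ell S A p q < m))).
  rewrite -[3]Q3 -sum_nat_const; apply: leq_sum => v vQ.
  have [t vt] := first v vQ.
  have := card_last_exits (inA v vQ) vt (_ : m < #|A|).
  have -> : m < #|A| by clear -mn; lia.
  move=> /(_ isT); rewrite -(cardsID Q).
  have : #|[set q in A :\ v | ell S A q v < m] :&: Q| <= #|Q :\ v|.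
    apply/subset_leq_card/fintype.subsetP => q; rewrite !inE.
    by move=> /andP[/andP[/andP[-> _] _] ->].
  have := cardsD1 v Q; rewrite vQ Q3.
  have : #|[set q in A :\ v | ell S A q v < m] :\: Q| <=
         #|[set q | (q \in A :\: Q) && (ell S A q v < m)]|.
    apply/subset_leq_card/fintype.subsetP => q; rewrite !inE.
    by move=> /andP[-> /andP[/andP[_ ->] ->]].
  by clear; lia.
have S3 : #|light S A Q m| <= #|(V :\: X1) :&: light S A Q m|.
  apply/subset_leq_card/fintype.subsetP => -[p q] H; rewrite finset.in_setI H andbT.
  move: H; rewrite !inE /= => /and5P[/andP[-> ->] -> -> /eqP-> _] /=.
  exact: leqnn.
have S4 : #|pairs_le (A :\: Q) (m - 2)| <=
          #|(V :\: X1 :\: light S A Q m) :\: X2|.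
  apply/subset_leq_card/fintype.subsetP => -[p q]; rewrite !inE /=.
  move=> /and4P[/andP[pQ pA] /andP[qQ qA] pq lm]; rewrite pQ pA qQ qA pq /=.
  have [t st] := exists_swaps S pq.
  have three : #|[set r in Q | left S p q r]| < 3.
    rewrite ltn_neqAle -{2}Q3 subset_leq_card ?andbT; last first.
      by apply/fintype.subsetP => r; rewrite inE => /andP[].
    apply/negP => /eqP E; have := thin t; apply/negP/negPn.
    have EQ : [set r in Q | left S p q r] = Q.
      apply/eqP; rewrite eqEcard E Q3 leqnn andbT.
      by apply/fintype.subsetP => r; rewrite inE => /andP[].
    have ellm : ell S A p q <= m.+1 by rewrite (ell_setD _ _ QA) E; clear -lm m1; lia.
    apply/fintype.subsetP => r rQ; rewrite !inE inA //=.
    move: (rQ); rewrite -{1}EQ inE (left_swaps _ st) rQ /= => brp.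
    by rewrite (leq_trans (rank_before (inA _ rQ) brp)) // -(ell_swaps _ st).
  have -> : ell S A p q <= m by rewrite (ell_setD _ _ QA); clear -lm three m1; lia.
  rewrite andbT; apply/negP => /andP[/eqP].
  by rewrite (ell_setD _ _ QA); clear -lm m1; lia.
rewrite -/V split; move: S1 S2 S3 S4 few; rewrite [m.+1.-1]/=.
by clear -m1; lia.
Qed.

(** The increment [6 m + (3 m - n)] of [pairs_le_peel], under [m -> m - 2] and
    [n -> n - 3], is that of [(9 m^2 + (3 m - n)^2) / 6] up to a constant. *)
Theorem card_pairs_le A m : m.+1.*2 < #|A| ->
  9 * m ^ 2 + (3 * m - #|A|) ^ 2 <= 6 * #|pairs_le A m| + 9 * m.
Proof.
have [k] := ubnP m; elim: k m A => // k IH m A mk mn.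
have [m1|m1] := leqP m 1.
  have -> : 3 * m - #|A| = 0 by clear -m1 mn; lia.
  by case: m m1 {mk mn} => [|[|]] // _; rewrite ?muln1; clear; lia.
have [Q [QA Q3 H]] := pairs_le_peel m1 mn.
have cQ : #|A :\: Q| + 3 = #|A|.
  by rewrite -Q3 cardsD (finset.setIidPr QA) subnK // subset_leq_card.
have := IH (m - 2) (A :\: Q).
have -> : m - 2 < k by clear -mk m1; lia.
have -> : (m - 2).+1.*2 < #|A :\: Q| by clear -cQ mn m1; lia.
move=> /(_ isT isT).
have -> : 3 * (m - 2) - #|A :\: Q| = (3 * m - #|A|) - 3 by clear -cQ m1; lia.
move: H; move: (3 * m - #|A|) => d; move: #|pairs_le _ _| #|pairs_le _ _| => V' V.
have [d3|d3] := ltnP d 3.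
  have -> : d - 3 = 0 by clear -d3; lia.
  have -> : m = (m - 2) + 2 by clear -m1; lia.
  rewrite addnK; move: (m - 2) => u; clear -d3; case: d d3 => [|[|[|]]] // _; nia.
have -> : d = (d - 3) + 3 by clear -d3; lia.
have -> : m = (m - 2) + 2 by clear -m1; lia.
rewrite !addnK; move: (m - 2) (d - 3) => u w; clear; nia.
Qed.

End Levels.

(** * Pairs swapping in the middle *)

Section Center.
Variables (T : finType) (S : allowable_sequence T) (A : {set T}) (k : nat).
Hypotheses (k0 : 0 < k) (kn : k.*2 < #|A|).
Implicit Types (t j : nat) (p q r : T).

Local Notation M := (half S).
Local Notation b := (before S).
Local Notation rk := (rank S A).
Local Notation n := #|A|.

Definition pairs_eq j := [set x : T * T |
  [&& x.1 \in A, x.2 \in A, x.1 != x.2 & ell S A x.1 x.2 == j]].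

(** These pairs swap inside the center defined next. *)
Definition pairs_mid := [set x : T * T |
  [&& x.1 \in A, x.2 \in A, x.1 != x.2 & k <= ell S A x.1 x.2 < (n - k).-1]].

Definition center t := [set p in A | k <= rk t p < n - k].

(** The center is the same after half a turn, so half a turn decides whether a
    point ever leaves it. *)
Definition core := [set p in A | [forall i : 'I_M, p \in center i]].

Definition gates := pairs_eq k.-1 :|: pairs_eq (n - k).-1.

(** At the left border the first point of the pair moves in, at the right border
    the second one. *)
Definition entering (g : T * T) := if ell S A g.1 g.2 == k.-1 then g.1 else g.2.

Lemma card_center t : #|center t| = n - k.*2.
Proof.
have -> : center t = zone S A (n - k) t :\: zone S A k t.
  by apply/setP => p; rewrite !inE; case: (p \in A) => //=; rewrite -leqNgt.
rewrite cardsD (finset.setIidPr _).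
  by rewrite !card_zone ?leq_subr //; clear -kn; lia.
by apply/fintype.subsetP => p; rewrite !inE => /andP[-> /=]; clear -kn; lia.
Qed.

Lemma center_half t : center (t + M) = center t.
Proof.
apply/setP => p; rewrite !inE; have [pA|//] := boolP (p \in A).
by have := rank_half S t pA; clear; lia.
Qed.

Lemma center_mod t u : t = u %[mod M] -> center t = center u.
Proof.
have E s : center (s %% M) = center s.
  rewrite [in RHS](divn_eq s M); elim: (s %/ _) => [|i IH].
    by rewrite mul0n add0n.
  by rewrite mulSn -addnA addnC center_half.
by move=> tu; rewrite -E tu E.
Qed.

Lemma modn_double t u : t = u %[mod M.*2] -> t = u %[mod M].
Proof.
have D : M %| M.*2 by rewrite -muln2 dvdn_mulr.
by move=> tu; rewrite -(modn_dvdm t D) -(modn_dvdm u D) tu.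
Qed.

Lemma half_gt0 : 0 < M.
Proof.
have n0 : 0 < n by clear -kn; lia.
have [p pA p0] := exists_rank S 0 n0; have := rank_half S 0 pA.
by case: (posnP M) => // ->; rewrite p0; clear -k0 kn; lia.
Qed.

Lemma core_center t : core \subset center t.
Proof.
apply/fintype.subsetP => p; rewrite inE => /andP[_ /forallP H].
have M0 : 0 < M := half_gt0.
have lt := ltn_pmod t M0; rewrite (@center_mod t (t %% M)) ?modn_mod //.
exact: (H (Ordinal lt)).
Qed.

Lemma leave_center p t : p \in A -> p \notin core ->
  exists2 u, t <= u < t + M & p \notin center u.
Proof.
move=> pA; rewrite inE pA negb_forall => /existsP[i pi].
have [u tu ui] := exists_window t i half_gt0.
by exists u; rewrite // (center_mod ui).
Qed.

Lemma enter_center u e : e \in A -> e \notin center u -> e \in center u.+1 ->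
  exists g, [/\ g \in gates, swaps S u g.1 g.2 & entering g = e].
Proof.
move=> eA; rewrite !inE eA /= => eu eu1.
have [E|[q qA st]|[q qA st]] := rank_step S A u e.
- by rewrite E (negbTE eu) in eu1.
- exists (e, q); rewrite /entering !inE /= eA qA (swaps_neq st) /= (ell_swaps _ st).
  have -> : rk u e == k.-1 by move: eu eu1; rewrite (rank_swapsl qA st); clear -k0; lia.
  by [].
- exists (q, e); rewrite /entering !inE /= eA qA (swaps_neq st) /= (ell_swaps _ st).
  have := rank_swaps qA eA st; have := rank_swapsr qA st.
  have [E|_] := eqVneq (rk u q) k.-1; first by move: eu eu1; clear -E k0 kn; lia.
  have [//|E] := eqVneq (rk u q) (n - k).-1.
  by move: eu eu1 E; clear -k0 kn; lia.
Qed.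

(** Each of these swaps is preceded, by less than half a turn, by a time when its
    two points were not both in the center. *)
Definition pairs_loose := [set x in pairs_mid | (x.1 \notin core) && (x.2 \notin core)].

(** An entrance into the center, together with another point present there that
    does not stay forever. *)
Definition charges := [set d : T * T * T | (d.1 \in gates) &&
  (d.2 \in (center (swap_time S d.1.1 d.1.2).+1 :\ entering d.1) :\: core)].

(** Within half a turn after the entrance, the two points of a charge swap at most
    once; the order they are in at the entrance tells which of the two ordered pairs
    is concerned. *)
Definition charged (d : T * T * T) :=
  if b (swap_time S d.1.1 d.1.2).+1 (entering d.1) d.2
  then (entering d.1, d.2) else (d.2, entering d.1).

Lemma modnS_eq d t u : t = u %[mod d] -> t.+1 = u.+1 %[mod d].
Proof. by move=> tu; rewrite -addn1 -modnDml tu modnDml addn1. Qed.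

(** The charge of a swap is the last entrance that made both points present, taken
    by one of them while the other was there. *)
Lemma pairs_loose_charged : pairs_loose \subset charged @: charges.
Proof.
apply/fintype.subsetP => -[x y]; rewrite inE /= => /andP[xy /andP[xc yc]].
move: xy; rewrite inE /= => /and4P[xA yA xy xymid].
pose t := swap_time S x y + M.*2.
have st : swaps S t x y.
  by rewrite /swaps -addSn !before_full; apply: swap_timeP.
pose both u := (x \in center u) && (y \in center u).
have both_t : both t.
  rewrite /both !inE xA yA (rank_swaps xA yA st) -(ell_swaps _ st).
  by move: xymid; clear; lia.
have [u0 /andP[u01 u02] xu0] := leave_center (t - M) xA xc.
pose P u := (u < t) && ~~ both u.
have Mt : M <= t by rewrite /t; clear; lia.
have Pu0 : P u0.
  by rewrite /P /both (negbTE xu0) /= andbT; clear -u02 Mt; lia.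
have exP : exists u, P u by exists u0.
have Pmax u : P u -> u <= t by case/andP=> /ltnW.
case: (ex_maxnP exP Pmax) => u /andP[ut nbu] umax.
have u_ge := umax _ Pu0.
have both_u1 : both u.+1.
  apply: contraT => h; have := umax u.+1; rewrite /P h andbT ltnn.
  have [_ /(_ isT)//|tu] := ltnP u.+1 t.
  by move: h; rewrite (_ : u.+1 = t) ?both_t //; clear -ut tu; lia.
have bxy : b u.+1 x y.
  rewrite before_total //; apply/negP => byx; have /andP[s1 s2] := st.
  have : b t y x.
    apply: (@before_convex _ S u.+1 t t.+1) => //; first by clear -ut; lia.
    by clear -u_ge u01; lia.
  by rewrite (before_asym s1).
suff [g [z [gg sg [Ex Ez]]]] : exists g z, [/\ g \in gates, swaps S u g.1 g.2 &
    z \in (center u.+1 :\ entering g) :\: core /\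
    (x, y) = if b u.+1 (entering g) z then (entering g, z) else (z, entering g)].
  have /andP[s1 s2] := sg; have E := modnS_eq (swap_time_mod s1 s2).
  apply/imsetP; exists (g, z).
    by rewrite inE /= gg /= -(center_mod (modn_double E)).
  by rewrite /charged /= -(before_mod _ _ E).
have /andP[x1 y1] := both_u1.
move: nbu; rewrite /both negb_and => /orP[xu|yu].
  have [g [gg sg eg]] := enter_center xA xu x1.
  exists g, y; split=> //; split.
    by rewrite finset.in_setD yc finset.in_setD1 eg eq_sym xy y1.
  by rewrite eg bxy.
have [g [gg sg eg]] := enter_center yA yu y1.
exists g, x; split=> //; split; first by rewrite finset.in_setD xc finset.in_setD1 eg xy x1.
by rewrite eg (before_asym bxy).
Qed.

Lemma card_pairs_eq_rev j : j.+2 <= n -> #|pairs_eq (n.-2 - j)| = #|pairs_eq j|.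
Proof.
move=> jn; rewrite -[LHS]sum1_card -[RHS]sum1_card.
rewrite (reindex_inj (h := fun x : T * T => (x.2, x.1))) /=.
  apply: eq_bigl => -[p q]; rewrite !inE /= [q == p]eq_sym.
  have [pA|] := boolP (p \in A); rewrite ?andbF //.
  have [qA|] := boolP (q \in A); rewrite ?andbF //.
  have [//|pq] := eqVneq p q; rewrite /=.
  have := ell_rev S pA qA pq => E.
  by apply/eqP/eqP; clear -E jn; lia.
by move=> [p q] [p' q'] [-> ->].
Qed.

Lemma card_gates : #|gates| <= 2 * #|pairs_eq k.-1|.
Proof.
have -> : 2 * #|pairs_eq k.-1| = #|pairs_eq k.-1| + #|pairs_eq (n - k).-1|.
  rewrite (_ : (n - k).-1 = n.-2 - k.-1); last by clear -k0 kn; lia.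
  by rewrite card_pairs_eq_rev; clear -k0 kn; lia.
by rewrite cardsU leq_subr.
Qed.

Lemma card_charges :
  #|charges| <= 2 * #|pairs_eq k.-1| * (n - k.*2 - 1 - #|core|).
Proof.
rewrite (card_pairs gates (fun g z => z \in (center (swap_time S g.1 g.2).+1
   :\ entering g) :\: core)).
apply: leq_trans (leq_mul card_gates (leqnn _)); rewrite -sum_nat_const.
apply: leq_sum => g gg.
have [gA1 gA2 gneq] : [/\ g.1 \in A, g.2 \in A & g.1 != g.2].
  by move: gg; rewrite !inE => /orP[] /and4P[-> ->].
set u := swap_time S g.1 g.2; have st : swaps S u g.1 g.2 := swap_timeP S gneq.
have elg := ell_swaps A st.
have e1 : entering g \in center u.+1.
  rewrite /entering; move: gg; rewrite !inE gA1 gA2 gneq /= elg.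
  have rl := rank_swapsl gA2 st; have rr := rank_swapsr gA1 st.
  have rs := rank_swaps gA1 gA2 st.
  case: eqP => [E _|_ /= /eqP E] /=; rewrite ?gA1 ?gA2 /=.
    by clear -rl E k0 kn; lia.
  by clear -rr rs E k0 kn; lia.
have e0 : entering g \notin center u.
  rewrite /entering; move: gg; rewrite !inE gA1 gA2 gneq /= elg.
  have rs := rank_swaps gA1 gA2 st.
  case: eqP => [E _|_ /= /eqP E] /=; rewrite ?gA1 ?gA2 /=.
    by clear -E k0 kn; lia.
  by clear -rs E k0 kn; lia.
have ec : entering g \notin core.
  by apply: contra e0; apply: (fintype.subsetP (core_center u)).
have Ec := cardsD1 (entering g) (center u.+1); rewrite e1 card_center in Ec.
have cs : core \subset center u.+1 :\ entering g.
  apply/fintype.subsetP => p pc; rewrite finset.in_setD1.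
  rewrite (fintype.subsetP (core_center u.+1) p pc) andbT.
  by apply: contraNneq ec => <-.
apply: (@leq_trans #|(center u.+1 :\ entering g) :\: core|).
  by apply/subset_leq_card/fintype.subsetP => z; rewrite inE.
by rewrite cardsD (finset.setIidPr cs) -subnDA; clear -Ec; lia.
Qed.

(** Pairs meeting the core are estimated by the number of all pairs with a point
    in the core. *)
Lemma card_pairs_mid :
  #|pairs_mid| <= 2 * #|core| * n + 2 * #|pairs_eq k.-1| * (n - k.*2 - 1 - #|core|).
Proof.
have coreA : core \subset A by apply/fintype.subsetP => p; rewrite inE => /andP[].
have H : pairs_mid \subset (finset.setX core A :|: finset.setX A core) :|: pairs_loose.
  apply/fintype.subsetP => -[x y] xm; rewrite 2!finset.in_setU !finset.in_setX.
  have -> : ((x, y) \in pairs_loose) = (x \notin core) && (y \notin core).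
    by rewrite inE xm.
  move: xm; rewrite inE => /and4P[-> -> _ _] /=; rewrite andbT.
  by case: (x \in core); case: (y \in core).
apply: leq_trans (subset_leq_card H) _; rewrite cardsU.
have := leq_trans (subset_leq_card pairs_loose_charged) (leq_imset_card _ _).
have := card_charges; rewrite cardsU !cardsX.
move: (2 * #|pairs_eq k.-1| * _) => G; move: #|_ :&: _| #|_ :&: _| => a c.
by clear; nia.
Qed.

Theorem card_pairs_mid_le (K := n - k.*2) :
  #|pairs_mid| <= 2 * n * K \/ #|pairs_mid| <= 2 * K.-1 * #|pairs_eq k.-1|.
Proof.
have := card_pairs_mid; have := subset_leq_card (core_center 0).
rewrite card_center -/K; move: #|core| #|pairs_eq k.-1| #|pairs_mid| => s W U.
have K0 : 0 < K by rewrite /K; clear -kn; lia.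
clearbody K; move: n => N sK H.
have [sK'|sK'] := eqVneq s K.
  by left; apply: leq_trans H _; rewrite sK'; clear; nia.
have [WN|WN] := leqP N W; [right|left]; apply: leq_trans H _.
  have {sK sK'} : exists c, K = s + c.+1.
    by exists (K - s).-1; clear -sK sK'; lia.
  case=> c ->; rewrite (_ : s + c.+1 - 1 - s = c); last by clear; lia.
  rewrite addnS /=; clear -WN; nia.
have {sK sK'} : exists c, K = s + c.+1.
  by exists (K - s).-1; clear -sK sK'; lia.
case=> c ->; rewrite (_ : s + c.+1 - 1 - s = c); last by clear; lia.
clear -WN; nia.
Qed.

End Center.

(** * Optimising the weighted sum *)

Section Numerics.
Local Open Scope ring_scope.
Variables (R : realFieldType) (n : nat) (U : nat -> R).
Local Notation N := (n%:R : R).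

Definition excess (m : nat) : R := (3 * m - n)%N%:R.

Lemma excess_step m :
  [\/ excess m.+1 = 0 /\ excess m = 0,
      [/\ excess m.+1 = 3 * m.+1%:R - N, 0 <= excess m.+1 <= 3 & excess m = 0]
    | [/\ excess m.+1 = 3 * m.+1%:R - N, 3 <= excess m.+1 & excess m = excess m.+1 - 3]].
Proof.
rewrite /excess; have [h1|h1] := leqP (3 * m.+1) n.
  have h2 : (3 * m <= n)%N by apply: leq_trans h1; lia.
  by constructor 1; split; [move: h1|move: h2]; rewrite -subn_eq0 => /eqP->.
have E1 : (3 * m.+1 - n)%N%:R = 3 * m.+1%:R - N by rewrite natrB ?natrM // ltnW.
have [h2|h2] := leqP (3 * m) n; [constructor 2|constructor 3].
  split=> //; last by move: h2; rewrite -subn_eq0 => /eqP->.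
  by rewrite ler0n -[3]/(3%:R) ler_nat; clear -h2; lia.
split=> //; first by rewrite -[3]/(3%:R) ler_nat; clear -h2; lia.
by rewrite E1 natrB ?(ltnW h2) // natrM -natr1; ring.
Qed.

(** At [u = 3 x - N], an antiderivative in [x] of
    [(N - 2 x) (N ^+ 2 - 3 x ^+ 2 - u ^+ 2 / 3)]. *)
Definition head_poly (x u : R) : R :=
  N ^+ 3 * x - N ^+ 2 * x ^+ 2 - N * x ^+ 3 + 3 / 2 * x ^+ 4
    - (N * u ^+ 3 / 3 - u ^+ 4 / 2) / 27.

(** A difference quotient of [head_poly] differs from its derivative by second
    order terms, which are quadratic in [N]. *)
Lemma head_poly_step (x u v : R) : 1 <= x -> 2 * x <= N ->
  [\/ u = 0 /\ v = 0, [/\ u = 3 * x - N, 0 <= u <= 3 & v = 0] |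
      [/\ u = 3 * x - N, 3 <= u & v = u - 3]] ->
  (N - 2 * x) * (N ^+ 2 - 3 * x ^+ 2 - u ^+ 2 / 3 + 6 * N)
  <= head_poly x u - head_poly (x - 1) v + 20 * N ^+ 2.
Proof.
rewrite /head_poly; move: (n%:R : R) => y x1 xy cases.
have y2 : 2 <= y by lra.
have poly : (y - 2 * x) * (y ^+ 2 - 3 * x ^+ 2 + 6 * y) <=
   y ^+ 3 * x - y ^+ 2 * x ^+ 2 - y * x ^+ 3 + 3 / 2 * x ^+ 4 -
   (y ^+ 3 * (x - 1) - y ^+ 2 * (x - 1) ^+ 2 - y * (x - 1) ^+ 3 + 3 / 2 * (x - 1) ^+ 4)
   + 10 * y ^+ 2.
  rewrite -subr_ge0 [leRHS](_ : _ = 5 * y ^+ 2 + 15 * x * y - y - 9 * x ^+ 2 + 6 * x - 3 / 2);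
    last by field.
  nra.
suff : (y * u ^+ 3 / 3 - u ^+ 4 / 2) / 27 - (y * v ^+ 3 / 3 - v ^+ 4 / 2) / 27
   <= (y - 2 * x) * (u ^+ 2 / 3) + 10 * y ^+ 2.
  by move: poly; rewrite !mulrDr; lra.
case: cases => [[-> ->]|[E /andP[u0 u3] ->]|[E u3 ->]].
- have y20 : 0 <= y ^+ 2 by rewrite sqr_ge0.
  by rewrite !expr0n /= ?(mul0r, mulr0) !subr0 mul0r subr0 add0r mulr_ge0.
- have xE : x = (u + y) / 3 by rewrite E; field.
  have h1 : u ^+ 3 <= 27 by nra.
  have h2 : 0 <= u ^+ 4 by rewrite exprn_even_ge0.
  have h3 : 0 <= (y - 2 * x) * (u ^+ 2 / 3) by apply: mulr_ge0; nra.
  have h4 : y * u ^+ 3 <= y * 27 by rewrite ler_wpM2l //; lra.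
  by rewrite !expr0n /=; nra.
- have xE : x = (u + y) / 3 by rewrite E; field.
  have -> : (y - 2 * x) * (u ^+ 2 / 3) = (y * u ^+ 2 - 2 * u ^+ 3) / 9.
    by rewrite xE; field.
  rewrite -subr_ge0 [leRHS](_ : _ = 10 * y ^+ 2 -
    (- 9 * y * u + 9 * y + 27 * u ^+ 2 - 54 * u + 81 / 2) / 27); last by field.
  have uy : 2 * u <= y by lra.
  nra.
Qed.

(** At [x = 4 y / 9] the left-hand side is [476 / 2187 * y ^+ 4]; the secant slopes
    below that point are at least [- y ^+ 3]. *)
Lemma head_cubic_le (y x : R) : 3 <= y -> 0 <= x -> 0 <= 4 / 9 * y - x <= 1 ->
  y ^+ 3 * x - y ^+ 2 * x ^+ 2 - y * x ^+ 3 + 3 / 2 * x ^+ 4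
    <= 476 / 2187 * y ^+ 4 + y ^+ 3.
Proof.
move=> y3 x0 /andP[x1 x2]; have y0 : 0 <= y by apply: le_trans y3.
have y30 : 0 <= y ^+ 3 by apply: exprn_ge0.
have [z zE] : exists z, z = 4 / 9 * y by exists (4 / 9 * y).
rewrite -zE in x1 x2; have xz : x <= z by rewrite -subr_ge0.
have z0 : 0 <= z by apply: le_trans xz.
pose B := - y ^+ 3 + y ^+ 2 * (z + x) + y * (z ^+ 2 + z * x + x ^+ 2)
       - 3 / 2 * (z ^+ 3 + z ^+ 2 * x + z * x ^+ 2 + x ^+ 3).
have E : y ^+ 3 * x - y ^+ 2 * x ^+ 2 - y * x ^+ 3 + 3 / 2 * x ^+ 4
        = 476 / 2187 * y ^+ 4 + (z - x) * B by rewrite /B zE; field.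
rewrite E lerD2l; apply: le_trans (_ : (z - x) * y ^+ 3 <= _); last by rewrite ler_piMl.
apply: ler_wpM2l => //.
have xz2 : x ^+ 2 <= z ^+ 2 by rewrite lerXn2r.
have h1 : y ^+ 2 * x <= y ^+ 2 * z by rewrite ler_wpM2l ?sqr_ge0.
have h2 : z * x <= z ^+ 2 by rewrite expr2 ler_wpM2l.
have h3 : y * (z ^+ 2 + z * x + x ^+ 2) <= y * (3 * z ^+ 2).
  by apply: ler_wpM2l => //; clear -xz2 h2; lra.
have h4 : 0 <= z ^+ 3 + z ^+ 2 * x + z * x ^+ 2 + x ^+ 3.
  by rewrite !addr_ge0 ?mulr_ge0 ?exprn_ge0.
have e1 : y ^+ 2 * z = 4 / 9 * y ^+ 3 by rewrite zE; ring.
have e2 : y * (3 * z ^+ 2) = 16 / 27 * y ^+ 3 by rewrite zE; field.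
rewrite /B mulrDr; clear -h1 h3 h4 e1 e2 y30.
by move: h1 h3 h4 e1 e2 y30; lra.
Qed.

Lemma head_quartic_ge (y u : R) : 3 <= y -> 0 <= u -> 0 <= y / 3 - u <= 3 ->
  1 / 4374 * y ^+ 4 - y ^+ 3 <= (y * u ^+ 3 / 3 - u ^+ 4 / 2) / 27.
Proof.
move=> y3 u0 /andP[u1 u2]; have y0 : 0 <= y by apply: le_trans y3.
have y30 : 0 <= y ^+ 3 by apply: exprn_ge0.
have [w wE] : exists w, w = y / 3 by exists (y / 3).
rewrite -wE in u1 u2; have uw : u <= w by rewrite -subr_ge0.
have w0 : 0 <= w by apply: le_trans uw.
pose B := y * (w ^+ 2 + w * u + u ^+ 2) / 3 - (w + u) * (w ^+ 2 + u ^+ 2) / 2.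
have E : (y * u ^+ 3 / 3 - u ^+ 4 / 2) / 27 = 1 / 4374 * y ^+ 4 - (w - u) * B / 27.
  by rewrite /B wE; field.
have uw2 : u ^+ 2 <= w ^+ 2 by rewrite lerXn2r.
have h2 : w * u <= w ^+ 2 by rewrite expr2 ler_wpM2l.
have h3 : y * (w ^+ 2 + w * u + u ^+ 2) <= y * (3 * w ^+ 2).
  by apply: ler_wpM2l => //; clear -uw2 h2; lra.
have h4 : 0 <= (w + u) * (w ^+ 2 + u ^+ 2).
  by rewrite mulr_ge0 ?addr_ge0 ?exprn_ge0.
have e2 : y * (3 * w ^+ 2) = y ^+ 3 / 3 by rewrite wE; field.
have BB : B <= 9 * y ^+ 3 by rewrite /B; clear -h3 h4 e2 y30; lra.
have h5 : (w - u) * B <= 3 * (9 * y ^+ 3).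
  have [B0|B0] := lerP B 0; last by apply: ler_pM => //; apply: ltW.
  apply: le_trans (_ : 0 <= _); first by rewrite mulr_ge0_le0.
  by rewrite !mulr_ge0.
by rewrite E; clear -h5; lra.
Qed.

(** The constant is the value of [head_poly] at [x = 4 N / 9], [u = N / 3]; its
    derivatives are cubic in [N], so rounding costs a cubic term. *)
Lemma head_poly_le (x u : R) : 3 <= N -> 0 <= u -> 0 <= x ->
  0 <= 4 / 9 * N - x <= 1 -> 0 <= N / 3 - u <= 3 ->
  head_poly x u <= 951 / 4374 * N ^+ 4 + 2 * N ^+ 3.
Proof.
move=> y3 u0 x0 x1 u1; have h1 := head_cubic_le y3 x0 x1.
have h2 := head_quartic_ge y3 u0 u1; rewrite /head_poly.
by move: h1 h2; clear; lra.
Qed.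

(** At [x = 4 N / 9] the bound on [v] has leading coefficient
    [1 - 48 / 81 - 1 / 27 = 10 / 27], and the other argument only [2 / 9]. *)
Lemma threshold_le (x u v : R) : 3 <= N -> 0 <= x -> 9 * x <= 4 * N ->
  4 * N <= 9 * x + 9 -> 0 <= u -> N <= 3 * u + 9 ->
  v <= N ^+ 2 - 3 * x ^+ 2 - u ^+ 2 / 3 + 6 * N ->
  Num.max v (2 * N * (N - 2 * x)) <= 10 / 27 * N ^+ 2 + 10 * N.
Proof.
move: (n%:R : R) => y y3 x0 x1 x2 u0 u2 hv.
have y0 : 0 <= y by apply: le_trans y3.
have y20 : 0 <= y ^+ 2 by rewrite sqr_ge0.
rewrite ge_max; apply/andP; split.
  have h1 : 16 / 81 * y ^+ 2 - 8 / 9 * y <= x ^+ 2.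
    apply: le_trans (_ : (4 / 9 * y - 1) ^+ 2 <= _); last first.
      by rewrite lerXn2r ?nnegrE //; clear -x2 y3; lra.
    by rewrite -subr_ge0 [leRHS](_ : _ = 1); [|field].
  have h2 : y ^+ 2 / 9 - 2 * y <= u ^+ 2.
    have [y9|y9] := lerP y 9.
      apply: le_trans (sqr_ge0 _); rewrite -oppr_ge0.
      rewrite [leRHS](_ : _ = y * (2 - y / 9)); last by field.
      by apply: mulr_ge0 => //; clear -y9; lra.
    apply: le_trans (_ : (y / 3 - 3) ^+ 2 <= _); last first.
      by rewrite lerXn2r ?nnegrE //; clear -y9 u2; lra.
    by rewrite -subr_ge0 [leRHS](_ : _ = 9); [|field].
  by clear -hv h1 h2 y0 y20; lra.
have : y * (y - 2 * x) <= y * (y / 9 + 2).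
  by apply: ler_wpM2l => //; clear -x2; lra.
by clear -y0 y20; lra.
Qed.

(** At [x = 4 N / 9] the factor [N - 2 x] is [N / 9]. *)
Lemma potential_le (x w : R) : 3 <= N -> 9 * x <= 4 * N -> 4 * N <= 9 * x + 9 ->
  0 <= w -> w <= 10 / 27 * N ^+ 2 + 10 * N ->
  (N - 2 * x) ^+ 2 / 5 * w <= 4 / 4374 * N ^+ 4 + 3 * N ^+ 3.
Proof.
move: (n%:R : R) => y y3 x1 x2 w0 hw; have y0 : 0 <= y by apply: le_trans y3.
apply: le_trans (_ : (y / 9 + 2) ^+ 2 / 5 * (10 / 27 * y ^+ 2 + 10 * y) <= _).
  apply: ler_pM => //; first by rewrite divr_ge0 ?sqr_ge0.
  by rewrite ler_pM2r ?invr_gt0 ?ltr0n // lerXn2r ?nnegrE //; clear -x1 x2 y3; lra.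
have -> : (y / 9 + 2) ^+ 2 / 5 * (10 / 27 * y ^+ 2 + 10 * y) =
   4 / 4374 * y ^+ 4 + (2 / 81 + 8 / 243) * y ^+ 3 + 32 / 27 * y ^+ 2 + 8 * y by field.
have h1 : 3 * y ^+ 2 <= y ^+ 3 by rewrite [leRHS]exprS ler_wpM2r ?sqr_ge0.
have h2 : 3 * y <= y ^+ 2 by rewrite expr2 ler_wpM2r.
by clear -h1 h2 y0; lra.
Qed.

Hypothesis U_ge0 : forall m, 0 <= U m.
Hypothesis U_le : forall m, (0 < m)%N -> (m.*2 < n)%N ->
  U m <= N ^+ 2 - 3 * m%:R ^+ 2 - excess m ^+ 2 / 3 + 6 * N.
Hypothesis U_rec : forall m, (1 < m)%N -> (m.*2 < n)%N ->
  U m <= 2 * N * (N - 2 * m%:R) \/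
  (N - 2 * m%:R) * U m <= (N - 2 * m%:R - 1) * U m.-1.

Lemma head_sum k : (k.*2 < n)%N ->
  \sum_(1 <= m < k.+1) (N - 1 - 2 * m%:R) * U m <=
  head_poly k%:R (excess k) + 20 * N ^+ 2 * k%:R.
Proof.
elim: k => [|k IH] kn.
  by rewrite big_geq // /head_poly /excess muln0 sub0n !expr0n /=; lra.
rewrite big_nat_recr //=.
have kn' : (k.*2 < n)%N by apply: leq_ltn_trans kn; rewrite doubleS; lia.
have := IH kn'; have hk : 2 * k.+1%:R <= N.
  by rewrite -[2]/(2%:R) -natrM ler_nat; clear -kn; lia.
have k1 : 1 <= k.+1%:R :> R by rewrite ler1n.
have := head_poly_step k1 hk (excess_step k).
rewrite [in k.+1%:R - 1]mulrSr addrK.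
have := U_le (ltn0Sn k) kn; move: (U_ge0 k.+1).
move: (U k.+1) (\sum_(_ <= _ < _) _) (_ + 6 * N) => v s q v0 vq.
set c := 20 * N ^+ 2; rewrite [in c * k.+1%:R]mulrSr mulrDr mulr1.
have : (N - 1 - 2 * k.+1%:R) * v <= (N - 2 * k.+1%:R) * q by nra.
lra.
Qed.

(** The second argument of the maximum itself satisfies the recursion that [U]
    satisfies when it exceeds it, so [level] satisfies it unconditionally. *)
Definition level m := Num.max (U m) (2 * N * (N - 2 * m%:R)).

(** Write [K = N - 2 m].  From [K level(m) <= (K - 1) level(m - 1)] the decrement
    of [K ^+ 2 / 5 * level] is at least [(K - 1) level(m)]: this is
    [5 (K - 1) ^+ 2 + (K - 1) K ^+ 2 <= K (K + 2) ^+ 2].  The factor [1 / 5] is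
    dictated by the leading terms, since [U] decays like the square root of [K]. *)
Lemma tail_sum k0 j : (0 < k0)%N -> ((k0 + j).*2 < n)%N ->
  \sum_(k0.+1 <= m < (k0 + j).+1) (N - 1 - 2 * m%:R) * U m <=
  (N - 2 * k0%:R) ^+ 2 / 5 * level k0 - (N - 2 * (k0 + j)%:R) ^+ 2 / 5 * level (k0 + j)%N.
Proof.
move=> k0_gt0; elim: j => [|j IH] jn; first by rewrite addn0 big_geq //; lra.
rewrite addnS big_nat_recr ?ltnS ?leq_addr //=.
have jn' : ((k0 + j).*2 < n)%N by apply: leq_ltn_trans jn; rewrite addnS doubleS; lia.
have {IH} := IH jn'; rewrite addnS in jn.
move: (k0 + j)%N jn jn' (ltn_addr j k0_gt0) => m mn _ m0.
have n0 : 0 <= N by rewrite ler0n.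
have U0 := U_ge0 m; have U1 := U_ge0 m.+1.
set K := N - 2 * m.+1%:R.
(* The recursion holds for [level] when [2 <= K]; when [K = 1] the last term of the sum
vanishes. *)
have K12 : K = 1 \/ 2 <= K.
  have -> : K = (n - m.+1.*2)%N%:R by rewrite natrB ?(ltnW mn) // -muln2 natrM mulrC.
  have [->|h] : (n - m.+1.*2 = 1 \/ 2 <= n - m.+1.*2)%N by clear -mn; lia.
    by left.
  by right; rewrite -[2]/(2%:R) ler_nat.
have := U_rec (m0 : (1 < m.+1)%N) mn; rewrite [m.+1.-1]/= -/K.
have EK : N - 2 * m%:R = K + 2 by rewrite /K -natr1; ring.
have -> : N - 1 - 2 * m.+1%:R = K - 1 by rewrite /K; ring.
rewrite /level EK -/K => rec.
set w := Num.max (U m) _; set w' := Num.max (U m.+1) _.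
have wU : U m <= w by rewrite le_max lexx.
have wN : 2 * N * (K + 2) <= w by rewrite le_max lexx orbT.
have w'U : U m.+1 <= w' by rewrite le_max lexx.
suff key : (K - 1) * U m.+1 + K ^+ 2 / 5 * w' <= (K + 2) ^+ 2 / 5 * w.
  by clear -key; lra.
have w0 : 0 <= w by apply: le_trans U0 wU.
case: K12 => K12.
  have : w' <= w.
    rewrite ge_max; apply/andP; split; last by move: wN; rewrite K12; lra.
    by case: rec => + ; move: wN; rewrite K12; lra.
  by rewrite K12; clear -w0; lra.
have rec' : K * w' <= (K - 1) * w.
  have h : K * (2 * N * K) <= (K - 1) * w.
    apply: le_trans (_ : _ <= (K - 1) * (2 * N * (K + 2))) _.
      rewrite -subr_ge0 [leRHS](_ : _ = 2 * N * (K - 2)); last by ring.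
      by apply: mulr_ge0; lra.
    by apply: ler_wpM2l => //; lra.
  have K0 : 0 <= K by lra.
  rewrite /w'; case: (lerP (U m.+1) (2 * N * K)) => [//|lt].
  case: rec => [le|le]; first by move: (lt_le_trans lt le); rewrite ltxx.
  by apply: le_trans le _; apply: ler_wpM2l => //; lra.
have w'0 : 0 <= w' by apply: le_trans U1 w'U.
have Kpos : 0 < K by lra.
rewrite -(ler_pM2l Kpos).
have h1 : (K - 1) * (K * U m.+1) <= (K - 1) * ((K - 1) * w).
  apply: ler_wpM2l; first by lra.
  by apply: le_trans rec'; apply: ler_wpM2l => //; lra.
have h2 : K ^+ 2 / 5 * (K * w') <= K ^+ 2 / 5 * ((K - 1) * w).
  by apply: ler_wpM2l => //; rewrite divr_ge0 ?sqr_ge0.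
have h3 : 0 <= w * (14 * K - 5) by apply: mulr_ge0 => //; lra.
have E : K * ((K + 2) ^+ 2 / 5 * w) = (K - 1) * ((K - 1) * w) +
   K ^+ 2 / 5 * ((K - 1) * w) + w * (14 * K - 5) / 5 by field.
by rewrite E; clear -h1 h2 h3; lra.
Qed.

Lemma level_ge0 m : 0 <= level m.
Proof. by rewrite le_max U_ge0. Qed.

Lemma weighted_sum_le :
  \sum_(1 <= m < n.+1./2) (N - 1 - 2 * m%:R) * U m
    <= 955 / 4374 * N ^+ 4 + 20 * N ^+ 3.
Proof.
have N0 : 0 <= N by rewrite ler0n.
have [n3|n3] := ltnP n 3.
  rewrite big_geq; last by clear -n3; lia.
  by rewrite addr_ge0 ?mulr_ge0 ?exprn_ge0 //; lra.
(* Beyond [4 n / 9] the recursion is stronger than the quadratic bound. *)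
pose k := (4 * n %/ 9)%N; pose j := (n.-1./2 - k)%N.
have k_gt0 : (0 < k)%N by rewrite /k; clear -n3; lia.
have kj : (k + j = n.-1./2)%N by rewrite /j /k; clear -n3; lia.
have kn : (k.*2 < n)%N by rewrite /k; clear -n3; lia.
have jn : ((k + j).*2 < n)%N by rewrite kj; clear -n3; lia.
have -> : n.+1./2 = (k + j).+1 by rewrite kj; clear -n3; lia.
rewrite (big_cat_nat (n := k.+1)) //=; last by rewrite ltnS leq_addr.
have y3 : 3 <= N by rewrite -[3]/(3%:R) ler_nat.
have x0 : 0 <= k%:R :> R by rewrite ler0n.
have x1 : 9 * k%:R <= 4 * N.
  by rewrite -[9]/(9%:R) -[4]/(4%:R) -!natrM ler_nat /k; clear; lia.
have x2 : 4 * N <= 9 * k%:R + 9.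
  by rewrite -[9]/(9%:R) -[4]/(4%:R) -!natrM -natrD ler_nat /k; clear; lia.
have u0 : 0 <= excess k by rewrite ler0n.
have u1 : 3 * excess k <= N.
  by rewrite -[3]/(3%:R) -!natrM ler_nat /k; clear; lia.
have u2 : N <= 3 * excess k + 9.
  by rewrite -[9]/(9%:R) -[3]/(3%:R) -!natrM -natrD ler_nat /k; clear; lia.
have hx : 20 * N ^+ 2 * k%:R <= 10 * N ^+ 3.
  have E : 10 * N ^+ 3 = 20 * N ^+ 2 * (N / 2) by field.
  rewrite E; apply: ler_wpM2l; first by rewrite mulr_ge0 ?sqr_ge0.
  by clear u0 u1 u2 x0 x2 y3; lra.
have hp : head_poly k%:R (excess k) <= 951 / 4374 * N ^+ 4 + 2 * N ^+ 3.
  by clear hx; apply: head_poly_le => //; apply/andP; split; lra.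
have hL := threshold_le y3 x0 x1 x2 u0 u2 (U_le k_gt0 kn).
have hT := potential_le y3 x1 x2 (level_ge0 k) hL.
have N30 : 0 <= N ^+ 3 by rewrite exprn_ge0.
have head := head_sum kn; have tail := tail_sum k_gt0 jn.
have last0 : 0 <= (N - 2 * (k + j)%:R) ^+ 2 / 5 * level (k + j).
  by rewrite mulr_ge0 ?level_ge0 ?divr_ge0 ?sqr_ge0.
by clear x0 x1 x2 u0 u1 u2 y3 N0 hL; rewrite -/(level k) in hT; lra.
Qed.

End Numerics.

(** * Sum of the products of side counts *)

Section Weights.
Variables (T : finType) (S : allowable_sequence T) (A : {set T}).
Local Notation n := #|A|.

(** Reversal maps the pairs with few points on the left to those with few points on
    the right; neither kind is in the middle. *)
Lemma card_pairs_mid_pairs_le m : 0 < m -> m.*2 < n ->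
  #|pairs_mid S A m| + 2 * #|pairs_le S A m.-1| <= n ^ 2.
Proof.
move=> m0 mn.
pose G := [set x : T * T |
  [&& x.1 \in A, x.2 \in A, x.1 != x.2 & (n - m).-1 <= ell S A x.1 x.2]].
have GE : #|G| = #|pairs_le S A m.-1|.
  rewrite -[LHS]sum1_card -[RHS]sum1_card.
  rewrite (reindex_inj (h := fun x : T * T => (x.2, x.1))) /=; last first.
    by move=> [p q] [p' q'] [-> ->].
  apply: eq_bigl => -[p q]; rewrite !inE /= [q == p]eq_sym.
  have [pA|] := boolP (p \in A); rewrite ?andbF //.
  have [qA|] := boolP (q \in A); rewrite ?andbF //.
  have [//|pq] := eqVneq p q; rewrite /=.
  have := ell_rev S pA qA pq => E.
  by apply/idP/idP; clear -E m0 mn; lia.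
rewrite mul2n -addnn addnA -{1}GE -[n ^ 2]mulnn -cardsX.
apply: card_disjoint3; try (by apply/fintype.subsetP => -[p q];
  rewrite finset.in_setX inE /= => /and4P[-> ->]);
  apply/pred0P => -[p q] /=; apply/negbTE/negP; rewrite !inE /=;
  move=> /andP[/and4P[_ _ _ h1] /and4P[_ _ _ h2]]; clear -h1 h2 m0 mn; lia.
Qed.

(** Passing from [m - 1] to [m] loses the pairs with exactly [m - 1] points on the
    left, and their reversals. *)
Lemma card_pairs_mid_pairs_eq m : 1 < m -> m.*2 < n ->
  #|pairs_mid S A m| + 2 * #|pairs_eq S A m.-1| <= #|pairs_mid S A m.-1|.
Proof.
move=> m1 mn; have E : #|pairs_eq S A (n - m).-1| = #|pairs_eq S A m.-1|.
  rewrite (_ : (n - m).-1 = n.-2 - m.-1); last by clear -m1 mn; lia.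
  by rewrite card_pairs_eq_rev //; clear -m1 mn; lia.
rewrite mul2n -addnn addnA -{1}E.
apply: card_disjoint3.
- apply/pred0P => -[p q] /=; apply/negbTE/negP; rewrite !inE /=.
  by move=> /andP[/and4P[_ _ _ h1] /and4P[_ _ _ /eqP h2]]; clear -h1 h2 m1 mn; lia.
- apply/pred0P => -[p q] /=; apply/negbTE/negP; rewrite !inE /=.
  by move=> /andP[/and4P[_ _ _ /eqP h1] /and4P[_ _ _ /eqP h2]]; clear -h1 h2 m1 mn; lia.
- apply/pred0P => -[p q] /=; apply/negbTE/negP; rewrite !inE /=.
  by move=> /andP[/and4P[_ _ _ /eqP h1] /and4P[_ _ _ h2]]; clear -h1 h2 m1 mn; lia.
- apply/fintype.subsetP => -[p q]; rewrite !inE /= => /and4P[-> -> -> /=].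
  by clear; lia.
- apply/fintype.subsetP => -[p q]; rewrite !inE /= => /and4P[-> -> -> /= /eqP->].
  by clear -m1 mn; lia.
- apply/fintype.subsetP => -[p q]; rewrite !inE /= => /and4P[-> -> -> /= /eqP->].
  by clear -m1 mn; lia.
Qed.

Lemma sum_weights N mu : mu.*2.+2 <= N ->
  \sum_(1 <= m < mu.+1) (N - 1 - 2 * m) = mu * (N - 2 - mu).
Proof.
elim: mu => [|mu IH] muN; first by rewrite big_geq.
rewrite big_nat_recr //= IH; last by clear -muN; lia.
have [c ->] : exists c, N = mu.+1.*2.+2 + c by exists (N - mu.+1.*2.+2); clear -muN; lia.
have -> : mu.+1.*2.+2 + c - 2 - mu = mu.+2 + c by clear; lia.
have -> : mu.+1.*2.+2 + c - 2 - mu.+1 = mu.+1 + c by clear; lia.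
have -> : mu.+1.*2.+2 + c - 1 - 2 * mu.+1 = c.+1 by clear; lia.
by rewrite !mulnDr mulSn !mulnS mulSn; clear; lia.
Qed.

(** Summation by parts: [l * r], as a function of the smaller of [l] and [r], has
    increments [N - 1 - 2 m]. *)
Lemma mul_eq_sum_weights N l r : (l + r).+2 = N ->
  l * r = \sum_(1 <= m < N.+1./2) (N - 1 - 2 * m) * (m <= l < (N - m).-1).
Proof.
move=> lrN; pose mu := minn l r.
have muN : mu.*2.+2 <= N by rewrite /mu; clear -lrN; lia.
have -> : l * r = mu * (N - 2 - mu).
  rewrite /mu; have [lr|lr] := leqP l r.
    by rewrite (_ : N - 2 - l = r) //; clear -lrN; lia.
  by rewrite (_ : N - 2 - r = l) 1?mulnC //; clear -lrN; lia.
rewrite -sum_weights // (big_nat_widen _ _ N.+1./2); last by clear -muN; lia.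
rewrite big_mkcond; apply: eq_big_nat => m /andP[m0 mN] /=.
have -> : (m < mu.+1) = (m <= l < (N - m).-1) by rewrite /mu; clear -lrN m0 mN; lia.
by case: ifP; rewrite ?muln1 ?muln0.
Qed.

Lemma sum_ell_mul :
  \sum_(x : T * T | [&& x.1 \in A, x.2 \in A & x.1 != x.2])
     ell S A x.1 x.2 * ell S A x.2 x.1 =
  \sum_(1 <= m < n.+1./2) (n - 1 - 2 * m) * #|pairs_mid S A m|.
Proof.
rewrite (eq_bigr (fun x : T * T => \sum_(1 <= m < n.+1./2) (n - 1 - 2 * m) *
    (m <= ell S A x.1 x.2 < (n - m).-1))); last first.
  by move=> x /and3P[x1 x2 x12]; apply: mul_eq_sum_weights; apply: ell_rev.
rewrite exchange_big /=; apply: eq_bigr => m _; rewrite -big_distrr /=; congr (_ * _).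
rewrite -[RHS]sum1_card big_mkcond [RHS]big_mkcond; apply: eq_bigr => x _ /=.
rewrite inE; case: (x.1 \in A) => //=; case: (x.2 \in A) => //=.
by case: (x.1 != x.2) => //=; case: (_ <= _ < _).
Qed.

Lemma card_pairs_mid_le_quadratic m : 0 < m -> m.*2 < n ->
  3 * #|pairs_mid S A m| + 9 * m ^ 2 + (3 * m - n) ^ 2 <= 3 * n ^ 2 + 18 * n.
Proof.
move=> m0 mn; have := card_pairs_mid_pairs_le m0 mn.
have := @card_pairs_le _ S A m.-1; rewrite prednK // => /(_ mn).
have {1}-> : 9 * m.-1 = 9 * m - 9 by clear -m0; lia.
move: #|pairs_mid S A m| #|pairs_le S A m.-1| => U V h1 h2.
have {h1 h2} : 3 * U + 9 * m.-1 ^ 2 + (3 * m.-1 - n) ^ 2 <= 3 * n ^ 2 + (9 * m - 9).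
  by clear -h1 h2; lia.
have -> : 3 * m.-1 - n = (3 * m - n) - 3 by clear; lia.
have dn : 2 * (3 * m - n) <= n by clear -mn; lia.
move: mn dn; move: (n) (3 * m - n) => N d.
case: m m0 => // m _ mn /=.
have [d3|d3] := leqP d 3.
  move=> _; rewrite (_ : d - 3 = 0); last by clear -d3; lia.
  have : d ^ 2 <= 9 by rewrite -[9]/(3 ^ 2) leq_sqr.
  by rewrite exp0n // -[m.+1]addn1 sqrnD exp1n !muln1; clear -mn; lia.
have [c ->] : exists c, d = c + 3 by exists (d - 3); clear -d3; lia.
by rewrite addnK -[m.+1]addn1 !sqrnD exp1n !muln1 => + cN; clear -mn cN; lia.
Qed.

Theorem sum_ell_mul_le (R : realFieldType) :
  ((\sum_(x : T * T | [&& x.1 \in A, x.2 \in A & x.1 != x.2])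
     ell S A x.1 x.2 * ell S A x.2 x.1)%:R
   <= 955 / 4374 * n%:R ^+ 4 + 20 * n%:R ^+ 3 :> R)%R.
Proof.
pose U m : R := (#|pairs_mid S A m|%:R)%R.
have U0 m : (0 <= U m)%R by rewrite ler0n.
have U1 m : 0 < m -> m.*2 < n ->
    (U m <= n%:R ^+ 2 - 3 * m%:R ^+ 2 - excess R n m ^+ 2 / 3 + 6 * n%:R)%R.
  move=> m0 mn; have := card_pairs_mid_le_quadratic m0 mn.
  rewrite -(ler_nat R) -!mulnn !natrD !natrM -/(excess R n m) -/(U m).
  by move: (excess R n m) (U m) => e u; lra.
have U2 m : 1 < m -> m.*2 < n -> (U m <= 2 * n%:R * (n%:R - 2 * m%:R) \/
    (n%:R - 2 * m%:R) * U m <= (n%:R - 2 * m%:R - 1) * U m.-1)%R.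
  move=> m1 mn; have := card_pairs_mid_le S (ltnW m1) mn; rewrite /=.
  have KE : ((n - m.*2)%N%:R = n%:R - 2 * m%:R :> R)%R.
    by rewrite natrB ?(ltnW mn) // -mul2n natrM.
  have KE1 : ((n - m.*2).-1%:R = n%:R - 2 * m%:R - 1 :> R)%R.
    by rewrite -KE -subn1 natrB // subn_gt0.
  have K1 : (1 <= n%:R - 2 * m%:R :> R)%R by rewrite -KE ler1n subn_gt0.
  case=> H; [left|right]; move: H; rewrite -(ler_nat R) !natrM -/(U m).
    by rewrite KE.
  rewrite KE1; have := card_pairs_mid_pairs_eq m1 mn.
  rewrite -(ler_nat R) natrD natrM -/(U m) -/(U m.-1).
  move: (#|pairs_eq _ _ _|%:R)%R (U m) (U m.-1) K1 => w u v.
  move: (n%:R - 2 * m%:R)%R => K K1 h1 h2.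
  have : ((K - 1) * (u + 2 * w) <= (K - 1) * v)%R by apply: ler_wpM2l => //; lra.
  by lra.
apply: le_trans (weighted_sum_le U0 U1 U2); rewrite sum_ell_mul natr_sum.
apply: ler_sum_nat => m /andP[m0 mn]; rewrite natrM ler_wpM2r //.
rewrite natrB; last by clear -m0 mn; lia.
by rewrite natrB ?natrM //; clear -m0 mn; lia.
Qed.

End Weights.

(** * Allowable sequences from swap times *)

Section FromSwapTimes.
Variables (T : finType) (lt : rel T) (M : nat) (tau : T -> T -> nat).
Hypotheses (lt_irr : irreflexive lt) (lt_trans : transitive lt).
Hypothesis lt_total : forall p q, p != q -> lt p q || lt q p.
Hypothesis M_gt0 : 0 < M.
Hypothesis tau_lt : forall p q, lt p q -> tau p q < M.
Hypothesis tau_inj : forall p q p' q', lt p q -> lt p' q' ->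
  tau p q = tau p' q' -> p = p' /\ q = q'.
Hypothesis tau_between : forall p q r, lt p q -> lt q r ->
  (tau p q < tau p r < tau q r) || (tau q r < tau p r < tau p q).

(** For [0 <= s < 2 M], the order after [s] swaps of the sequence that starts from
    [lt], reverses [lt] during the first [M] swaps, and restores it during the next
    [M]. *)
Definition order_at s p q :=
  (lt p q && ~~ (tau p q < s <= tau p q + M)) ||
  (lt q p && (tau q p < s <= tau q p + M)).

Definition swap_at p q := if lt p q then tau p q else tau q p + M.

Lemma lt_asym p q : lt p q -> lt q p = false.
Proof.
move=> pq; apply/negbTE/negP => qp.
by have := lt_trans pq qp; rewrite lt_irr.
Qed.

Lemma order_at_lt s p q : lt p q -> order_at s p q = ~~ (tau p q < s <= tau p q + M).
Proof. by move=> pq; rewrite /order_at pq (lt_asym pq) orbF. Qed.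

Lemma order_at_gt s p q : lt q p -> order_at s p q = (tau q p < s <= tau q p + M).
Proof. by move=> qp; rewrite /order_at qp (lt_asym qp). Qed.

Lemma order_at_irr s p : order_at s p p = false.
Proof. by rewrite /order_at lt_irr. Qed.

Lemma order_at_total s p q : p != q -> order_at s p q = ~~ order_at s q p.
Proof.
move=> /lt_total /orP[] h; first by rewrite order_at_lt // order_at_gt.
by rewrite order_at_gt // order_at_lt // negbK.
Qed.

(** Transitivity only involves three points, and their three swaps occur in one of
    the two orders that sort or unsort a list of three by adjacent swaps. *)
Lemma order_at_trans s : transitive (order_at s).
Proof.
move=> q p r; have [->|pq] := eqVneq p q; first by rewrite order_at_irr.
have [->|qr] := eqVneq q r; first by rewrite order_at_irr.
have [->|pr] := eqVneq p r.
  by rewrite order_at_total 1?eq_sym // => /negbTE->.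
have /orP[h1|h1] := lt_total pq; have /orP[h2|h2] := lt_total qr;
  have /orP[h3|h3] := lt_total pr.
- have := tau_between h1 h2; have := tau_lt h1; have := tau_lt h2; have := tau_lt h3.
  by rewrite !order_at_lt //; clear; lia.
- by rewrite (lt_asym (lt_trans h1 h2)) in h3.
- have := tau_between h3 h2; have := tau_lt h1; have := tau_lt h2; have := tau_lt h3.
  by rewrite (order_at_lt s h1) (order_at_gt s h2) (order_at_lt s h3); clear; lia.
- have := tau_between h3 h1; have := tau_lt h1; have := tau_lt h2; have := tau_lt h3.
  by rewrite (order_at_lt s h1) (order_at_gt s h2) (order_at_gt s h3); clear; lia.
- have := tau_between h1 h3; have := tau_lt h1; have := tau_lt h2; have := tau_lt h3.
  by rewrite (order_at_gt s h1) (order_at_lt s h2) (order_at_lt s h3); clear; lia.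
- have := tau_between h2 h3; have := tau_lt h1; have := tau_lt h2; have := tau_lt h3.
  by rewrite (order_at_gt s h1) (order_at_lt s h2) (order_at_gt s h3); clear; lia.
- by rewrite (lt_asym (lt_trans h2 h1)) in h3.
- have := tau_between h2 h1; have := tau_lt h1; have := tau_lt h2; have := tau_lt h3.
  by rewrite !order_at_gt //; clear; lia.
Qed.

Lemma modn_shift d t e : 0 < d -> e < d ->
  (t + e) %% d = if t %% d + e < d then t %% d + e else t %% d + e - d.
Proof.
move=> d0 ed; rewrite -modnDml; have := ltn_pmod t d0; move: (t %% d) => s sd.
have [h|h] := ltnP (s + e) d; first by rewrite modn_small.
by rewrite -{1}(subnK h) modnDr modn_small //; clear -sd ed h; lia.
Qed.

Let before_at t := order_at (t %% M.*2).

Lemma before_at_half t p q : before_at (t + M) p q = before_at t q p.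
Proof.
have [->|pq] := eqVneq p q; first by rewrite /before_at !order_at_irr.
have D0 : 0 < M.*2 by clear -M_gt0; lia.
have DM : M < M.*2 by clear -M_gt0; lia.
rewrite /before_at (modn_shift t D0 DM); have := ltn_pmod t D0.
move: (t %% _) => s sD; have /orP[h|h] := lt_total pq; have := tau_lt h.
  by rewrite (order_at_lt _ h) (order_at_gt _ h); case: ifP; clear -sD; lia.
by rewrite (order_at_gt _ h) (order_at_lt _ h); case: ifP; clear -sD; lia.
Qed.

Lemma before_at_convex t1 t2 t3 p q : t1 <= t2 <= t3 -> t3 <= t1 + M ->
  before_at t1 p q -> before_at t3 p q -> before_at t2 p q.
Proof.
have [->|pq] := eqVneq p q; first by rewrite /before_at !order_at_irr.
have D0 : 0 < M.*2 by clear -M_gt0; lia.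
move=> /andP[h12 h23] h13.
have {h12} [d2 E2] : exists d, t2 = t1 + d by exists (t2 - t1); rewrite subnKC.
have {h23} [d3 E3] : exists d, t3 = t2 + d by exists (t3 - t2); rewrite subnKC.
have H d : d <= d2 + d3 -> (t1 + d) %% M.*2 =
    if t1 %% M.*2 + d < M.*2 then t1 %% M.*2 + d else t1 %% M.*2 + d - M.*2.
  by move=> h; apply: modn_shift => //; clear -E2 E3 h13 M_gt0 h; lia.
have d23 : d2 + d3 <= M by clear -E2 E3 h13; lia.
rewrite E3 E2 -addnA /before_at !H ?leq_addr //; have := ltn_pmod t1 D0.
move: (t1 %% _) => s sD; have /orP[h|h] := lt_total pq; have := tau_lt h.
  by rewrite !(order_at_lt _ h); do 2!case: ifP; clear -sD d23; lia.
by rewrite !(order_at_gt _ h); do 2!case: ifP; clear -sD d23; lia.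
Qed.

Lemma before_at_swap t p q : before_at t p q -> before_at t.+1 q p ->
  t %% M.*2 = swap_at p q.
Proof.
have [->|pq] := eqVneq p q; first by rewrite /before_at !order_at_irr.
have D0 : 0 < M.*2 by clear -M_gt0; lia.
have D1 : 1 < M.*2 by clear -M_gt0; lia.
rewrite /before_at -[t.+1]addn1 (modn_shift t D0 D1); have := ltn_pmod t D0.
move: (t %% _) => s sD; have /orP[h|h] := lt_total pq; have := tau_lt h.
  rewrite (order_at_lt _ h) (order_at_gt _ h) /swap_at h.
  by case: ifP; clear -sD; lia.
rewrite (order_at_gt _ h) (order_at_lt _ h) /swap_at (lt_asym h).
by case: ifP; clear -sD; lia.
Qed.

Lemma swap_at_lt p q : p != q -> swap_at p q < M.*2.
Proof.
rewrite /swap_at => /lt_total/orP[h|h]; have := tau_lt h; rewrite ?h ?(lt_asym h);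
  by clear; lia.
Qed.

Lemma swap_atP p q : p != q ->
  before_at (swap_at p q) p q && before_at (swap_at p q).+1 q p.
Proof.
move=> pq; have D0 : 0 < M.*2 by clear -M_gt0; lia.
have D1 : 1 < M.*2 by clear -M_gt0; lia.
rewrite /before_at -[(swap_at p q).+1]addn1 (modn_shift _ D0 D1).
rewrite modn_small ?swap_at_lt //; have /orP[h|h] := lt_total pq; have := tau_lt h.
  rewrite (order_at_lt _ h) (order_at_gt _ h) /swap_at h.
  by case: ifP; clear; lia.
rewrite (order_at_gt _ h) (order_at_lt _ h) /swap_at (lt_asym h).
by case: ifP; clear; lia.
Qed.

Lemma swap_at_inj p q p' q' : p != q -> p' != q' ->
  swap_at p q = swap_at p' q' -> p = p' /\ q = q'.
Proof.
rewrite /swap_at => /lt_total/orP[h|h] /lt_total/orP[h'|h'];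
  rewrite ?h ?h' ?(lt_asym h) ?(lt_asym h'); have := tau_lt h; have := tau_lt h'.
- by move=> _ _; apply: tau_inj.
- by clear; lia.
- by clear; lia.
- by move=> _ _ /addIn/(tau_inj h h')[-> ->].
Qed.

(** An order [lt] and one swap time for each pair suffice: the only condition is that
    for [p], [q], [r] in this order the swap of the outer pair falls between the
    other two. *)
Definition sequence_of_swap_times : allowable_sequence T.
Proof.
refine (@AllowableSequence T M before_at swap_at _ _ _ _ _ _ _ _).
- by move=> t p; apply: order_at_irr.
- by move=> t p q; apply: order_at_total.
- by move=> t; apply: order_at_trans.
- exact: before_at_half.
- exact: before_at_convex.
- exact: swap_atP.
- move=> t p q h1 h2; have pq : p != q.
    by apply: contraTneq h1 => ->; rewrite /before_at order_at_irr.
  by rewrite (before_at_swap h1 h2) modn_small // swap_at_lt.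
- move=> t p q p' q' h1 h2 h3 h4.
  have pq : p != q by apply: contraTneq h1 => ->; rewrite /before_at order_at_irr.
  have pq' : p' != q' by apply: contraTneq h3 => ->; rewrite /before_at order_at_irr.
  by apply: swap_at_inj => //; rewrite -(before_at_swap h1 h2) (before_at_swap h3 h4).
Defined.

Lemma left_sequence p q r : p != q ->
  left sequence_of_swap_times p q r = order_at (swap_at p q) r p.
Proof. by move=> pq; rewrite /left /= /before_at modn_small // swap_at_lt. Qed.

End FromSwapTimes.

(** * The allowable sequence of a planar point set *)

Section Orientation.
Local Open Scope ring_scope.
Variable R : realFieldType.
Implicit Types p q r s : (R * R)%type.

Definition det p q r : R := (q.1 - p.1) * (r.2 - p.2) - (q.2 - p.2) * (r.1 - p.1).

Lemma det_rot p q r : det q r p = det p q r.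
Proof. by rewrite /det; ring. Qed.

Lemma det_swap p q r : det q p r = - det p q r.
Proof. by rewrite /det; ring. Qed.

(** The relation between the orientations of the four triangles of a quadrangle. *)
Lemma det_four p q r s : det p q r - det p q s + det p r s - det q r s = 0.
Proof. by rewrite /det; ring. Qed.

(** The parameters are the ratios in which each segment is cut by the line of the
    other. *)
Lemma segments_cross p q r s :
  det p q r * det p q s < 0 -> det r s p * det r s q < 0 ->
  exists t u : R, [/\ 0 < t < 1, 0 < u < 1 &
    ((1 - t) * p.1 + t * q.1, (1 - t) * p.2 + t * q.2) =
    ((1 - u) * r.1 + u * s.1, (1 - u) * r.2 + u * s.2)].
Proof.
have ratio (a b : R) : a * b < 0 -> a - b != 0 /\ 0 < a / (a - b) < 1.
  move=> ab; have [a0|a0|a0] := ltrgtP a 0; last by rewrite a0 mul0r ltxx in ab.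
    have b0 : 0 < b by move: ab; rewrite nmulr_rlt0.
    split; first by apply/eqP; lra.
    by rewrite ltr_ndivlMr ?ltr_ndivrMr; try (apply/andP; split); lra.
  have b0 : b < 0 by move: ab; rewrite pmulr_rlt0.
  split; first by apply/eqP; lra.
  by rewrite ltr_pdivlMr ?ltr_pdivrMr; try (apply/andP; split); lra.
move=> /ratio [d1 h1] /ratio [d2 h2].
exists (det r s p / (det r s p - det r s q)), (det p q r / (det p q r - det p q s)).
split=> //; move: d1 d2; rewrite /det => d1 d2.
by congr (_, _); field; rewrite d1 d2.
Qed.

End Orientation.

Section PointSequence.
Local Open Scope ring_scope.
Variables (R : realType) (T : finType) (pt : T -> R * R).
Hypothesis pt_inj : injective pt.
Hypothesis pt_general : forall p q r, p != q -> p != r -> q != r ->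
  det (pt p) (pt q) (pt r) != 0.
Implicit Types p q r s : T.

(** Projection onto the first axis, rotated infinitesimally to separate points with
    the same abscissa. *)
Definition lexi p q := ((pt p).1 < (pt q).1) ||
  (((pt p).1 == (pt q).1) && ((pt p).2 < (pt q).2)).

(** A vertical pair swaps last, hence the infinite slope. *)
Definition slope (x : T * T) : \bar R :=
  if (pt x.1).1 == (pt x.2).1 then +oo%E
  else (((pt x.2).2 - (pt x.1).2) / ((pt x.2).1 - (pt x.1).1))%:E.

(** Pairs of equal slope are disjoint, by general position, and may swap in any
    order. *)
Definition by_slope := sort (fun x y => (slope x <= slope y)%O)
  (enum [set x : T * T | lexi x.1 x.2]).

Definition slope_rank p q := index (p, q) by_slope.

Lemma lexi_irr : irreflexive lexi.
Proof. by move=> p; rewrite /lexi !ltxx andbF. Qed.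

Lemma lexi_trans : transitive lexi.
Proof.
move=> q p r /orP[h1|/andP[/eqP e1 h1]] /orP[h2|/andP[/eqP e2 h2]]; rewrite /lexi.
- by rewrite (lt_trans h1 h2).
- by rewrite -e2 h1.
- by rewrite e1 h2.
- by rewrite e1 e2 eqxx (lt_trans h1 h2) orbT.
Qed.

Lemma lexi_total p q : p != q -> lexi p q || lexi q p.
Proof.
move=> pq; rewrite /lexi; have [//|//|e /=] := ltrgtP (pt p).1 (pt q).1.
have [//|//|e2] := ltrgtP (pt p).2 (pt q).2.
case/eqP: pq; apply: pt_inj; move: e e2; case: (pt p) (pt q) => [a b] [c d] /=.
by move=> -> ->.
Qed.

Lemma mem_by_slope p q : ((p, q) \in by_slope) = lexi p q.
Proof. by rewrite mem_sort mem_enum inE. Qed.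

Lemma slope_rank_lt p q : lexi p q -> (slope_rank p q < size by_slope)%N.
Proof. by rewrite index_mem mem_by_slope. Qed.

Lemma slope_rank_inj p q p' q' : lexi p q -> lexi p' q' ->
  slope_rank p q = slope_rank p' q' -> p = p' /\ q = q'.
Proof.
rewrite -!mem_by_slope => h h' /(congr1 (nth (p, q) by_slope)).
by rewrite !nth_index // => -[-> ->].
Qed.

Lemma slope_rank_mono x y : lexi x.1 x.2 -> lexi y.1 y.2 ->
  (slope x < slope y)%O -> (slope_rank x.1 x.2 < slope_rank y.1 y.2)%N.
Proof.
move: x y => [p q] [p' q'] /= h h' xy; rewrite ltnNge; apply/negP => le.
have tr : transitive (fun x y : T * T => (slope x <= slope y)%O).
  by move=> a b c; apply: le_trans.
have so : sorted (fun x y : T * T => (slope x <= slope y)%O) by_slope.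
  by apply: sort_sorted => a b; apply: le_total.
have re : reflexive (fun x y : T * T => (slope x <= slope y)%O) by move=> a; apply: lexx.
have := sorted_leq_index tr re so (p', q') (p, q).
by rewrite !mem_by_slope => /(_ h' h le); rewrite leNgt xy.
Qed.

Lemma lt_ratio (a b c d : R) : 0 < b -> 0 < d -> (a / b < c / d) = (a * d < c * b).
Proof. by move=> b0 d0; rewrite ltr_pdivrMr // mulrAC ltr_pdivlMr. Qed.

(** The slope of the long side of a triangle is between those of the other two, and
    the orientation of the triangle decides which of these is smaller. *)
Lemma slope_between p q r : lexi p q -> lexi q r ->
  if 0 < det (pt p) (pt q) (pt r)
  then (slope (p, q) < slope (p, r) < slope (q, r))%O
  else (slope (q, r) < slope (p, r) < slope (p, q))%O.
Proof.
move=> pq qr; have pr := lexi_trans pq qr.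
have nz : det (pt p) (pt q) (pt r) != 0.
  by apply: pt_general; [apply: contraTneq pq|apply: contraTneq pr|
    apply: contraTneq qr] => ->; rewrite lexi_irr.
move: nz pq qr; rewrite /slope /lexi /det /=.
move: (pt p) (pt q) (pt r) => [a a'] [b b'] [c c'] /= {pr} nz h1 h2.
have ac : a <= c.
  by case/orP: h1 => [h1|/andP[/eqP-> _]]; case/orP: h2 => [h2|/andP[/eqP<- _]];
    rewrite ?lexx ?(ltW h1) ?(ltW h2) // ltW // (lt_trans h1 h2).
have [D DE] : exists D, D = (b - a) * (c' - a') - (b' - a') * (c - a).
  by exists ((b - a) * (c' - a') - (b' - a') * (c - a)).
rewrite -DE in nz *.
case/orP: h1 => [h1|/andP[/eqP e1 h1]]; case/orP: h2 => [h2|/andP[/eqP e2 h2]].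
- have h3 := lt_trans h1 h2; rewrite !lt_eqF // !lte_fin !lt_ratio ?subr_gt0 //.
  by case: (ltrgtP 0 D) nz => //= hD _; apply/andP; split; lra.
- have h3 : 0 < (b - a) * (c' - b') by rewrite mulr_gt0 ?subr_gt0.
  have -> : 0 < D by rewrite DE -e2; lra.
  rewrite -e2 eqxx lt_eqF // !lte_fin ltey /= andbT lt_ratio ?subr_gt0 //.
  by lra.
- have h3 : 0 < (c - b) * (b' - a') by rewrite mulr_gt0 ?subr_gt0.
  have -> : (0 < D) = false by apply/negbTE; rewrite -leNgt DE e1; lra.
  rewrite e1 eqxx lt_eqF // !lte_fin ltey /= andbT lt_ratio ?subr_gt0 //.
  by lra.
- by case/eqP: nz; rewrite DE e1 e2; ring.
Qed.

Lemma slope_rank_det p q r : lexi p q -> lexi q r ->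
  if 0 < det (pt p) (pt q) (pt r)
  then (slope_rank p q < slope_rank p r < slope_rank q r)%N
  else (slope_rank q r < slope_rank p r < slope_rank p q)%N.
Proof.
move=> pq qr; have pr := lexi_trans pq qr; have := slope_between pq qr.
by case: ifP => _ /andP[h1 h2]; apply/andP; split;
  apply: (slope_rank_mono (x := (_, _)) (y := (_, _))).
Qed.

Hypothesis T_gt1 : (1 < #|T|)%N.

Lemma by_slope_gt0 : (0 < size by_slope)%N.
Proof.
have /card_gt1P[p [q [_ _ pq]]] := T_gt1.
by case/orP: (lexi_total pq) => /slope_rank_lt; apply: leq_trans.
Qed.

Lemma slope_rank_between p q r : lexi p q -> lexi q r ->
  (slope_rank p q < slope_rank p r < slope_rank q r)%N ||
  (slope_rank q r < slope_rank p r < slope_rank p q)%N.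
Proof.
by move=> pq qr; have := slope_rank_det pq qr; case: ifP => _ ->; rewrite ?orbT.
Qed.

Definition point_sequence : allowable_sequence T :=
  sequence_of_swap_times lexi_irr lexi_trans lexi_total by_slope_gt0
    slope_rank_lt slope_rank_inj slope_rank_between.

Lemma left_point_sequence p q r : p != q -> p != r -> q != r ->
  left point_sequence p q r = (det (pt p) (pt q) (pt r) < 0).
Proof.
wlog pq : p q / lexi p q.
  move=> W pq pr qr; have /orP[|h] := lexi_total pq; first by move/W; apply.
  rewrite -[LHS]negbK -left_rev // 1?eq_sym // W // 1?eq_sym //.
  by rewrite det_swap oppr_lt0 -leNgt lt_neqAle pt_general // 1?eq_sym.
move=> npq npr nqr; rewrite left_sequence // /swap_at pq.
have nz := pt_general npq npr nqr; have pq_lt := slope_rank_lt pq.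
have neg_pos : (det (pt p) (pt q) (pt r) < 0) = ~~ (0 < det (pt p) (pt q) (pt r)).
  by rewrite -leNgt lt_neqAle nz.
rewrite neg_pos; have /orP[pr|rp] := lexi_total npr.
  rewrite (order_at_gt _ _ lexi_irr lexi_trans) //; have pr_lt := slope_rank_lt pr.
  have /orP[qr|rq] := lexi_total nqr.
    by have := slope_rank_det pq qr; case: ifP => _; clear -pq_lt pr_lt; lia.
  have := slope_rank_det pr rq.
  rewrite -[det (pt p) (pt r) _]det_rot det_swap det_rot oppr_gt0 neg_pos.
  by case: ifP => _; clear -pq_lt pr_lt; lia.
rewrite (order_at_lt _ _ lexi_irr lexi_trans) //.
have := slope_rank_det rp pq; rewrite -det_rot.
by case: ifP => _; clear -pq_lt; lia.
Qed.

End PointSequence.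

(** * Separations and crossings among four points *)

Section Quadruples.
Variable T : finType.
Local Notation quad := ((T * T) * (T * T))%type.
Implicit Types (x : quad).

Definition distinct4 x := uniq [:: x.1.1; x.1.2; x.2.1; x.2.2].

Lemma card_distinct4 : #|[set x | distinct4 x]| = #|T| ^_ 4.
Proof.
rewrite -card_uniq_tuples.
pose f x : 4.-tuple T := [tuple x.1.1; x.1.2; x.2.1; x.2.2].
have f_inj : injective f.
  by move=> [[a b] [c d]] [[a' b'] [c' d']] [-> -> -> ->].
rewrite -(card_imset _ f_inj); apply: eq_card => t; rewrite inE.
apply/imsetP/andP => [[x + ->]|[_ tu]].
  by rewrite inE /distinct4 => h; split=> //; apply/allP.
case/tupleP: t tu => a t; case/tupleP: t => b t; case/tupleP: t => c t.
case/tupleP: t => d t; rewrite tuple0 => tu.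
exists ((a, b), (c, d)); last by apply: val_inj.
by rewrite inE.
Qed.

Variable side : T -> T -> T -> bool.
Hypothesis side_rot : forall p q r, p != q -> p != r -> q != r ->
  side q r p = side p q r.
Hypothesis side_swap : forall p q r, p != q -> p != r -> q != r ->
  side q p r = ~~ side p q r.
Hypothesis side_four : forall p q r s, uniq [:: p; q; r; s] ->
  ~~ [&& side p q r == side p r s, side p q s == side q r s &
         side p q r != side p q s].

Definition separates x := side x.1.1 x.1.2 x.2.1 != side x.1.1 x.1.2 x.2.2.

Definition crossing x := separates x && separates (x.2, x.1).

(** Equality holds: a convex quadrangle has two separating pairs and one crossing,
    a triangle with an inner point has three separating pairs and no crossing.  The
    inequality is checked on the signs of the four triangles, of which
    [side_four] rules out two combinations. *)
Lemma separates_three x : distinct4 x ->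
  let: ((p, q), (r, s)) := x in
  3 <= separates ((p, q), (r, s)) + separates ((r, s), (p, q))
     + separates ((p, r), (q, s)) + separates ((q, s), (p, r))
     + separates ((p, s), (q, r)) + separates ((q, r), (p, s))
     + crossing ((p, q), (r, s)) + crossing ((p, r), (q, s)) + crossing ((p, s), (q, r)).
Proof.
case: x => [[p q] [r s]]; rewrite /distinct4 => U.
have [pq [pr [ps [qr [qs rs]]]]] : p != q /\ p != r /\ p != s /\ q != r /\ q != s /\ r != s.
  move: U; rewrite /= !inE !negb_or -!andbA.
  by move=> /and5P[-> -> -> -> /andP[-> /andP[-> _]]].
have swap23 a c e : a != c -> a != e -> c != e -> side a e c = ~~ side a c e.
  move=> ac ae ce; rewrite -(side_rot ae ac) 1?eq_sym // -(side_rot ac ae ce).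
  by rewrite side_swap // eq_sym.
have := side_four U; rewrite /crossing /separates /=.
rewrite (side_rot pr ps rs) (side_rot qr qs rs) (side_rot pq ps qs) (side_rot pq pr qr).
rewrite (swap23 p q r) // (swap23 p q s) // (swap23 p r s) // (swap23 q r s) //.
by case: (side p q r); case: (side p q s); case: (side p r s); case: (side q r s).
Qed.

Definition num_separations := \sum_(x | distinct4 x) separates x.

Lemma reindex_quad (F : quad -> nat) (g : quad -> quad) : injective g ->
  (forall x, perm_eq [:: (g x).1.1; (g x).1.2; (g x).2.1; (g x).2.2]
                     [:: x.1.1; x.1.2; x.2.1; x.2.2]) ->
  \sum_(x | distinct4 x) F (g x) = \sum_(x | distinct4 x) F x.
Proof.
move=> g_inj g_perm; rewrite [RHS](reindex_inj g_inj); apply: eq_bigl => x.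
by rewrite /distinct4 (perm_uniq (g_perm x)).
Qed.

(** Sum [separates_three] over all quadruples: the nine terms are obtained from one
    separation and one crossing by permuting the four points. *)
Lemma falling_le_separations :
  #|T| ^_ 4 <= 2 * num_separations + #|[set x | distinct4 x && crossing x]|.
Proof.
have perm4 (a b c d : T) : [/\ perm_eq [:: c; d; a; b] [:: a; b; c; d],
    perm_eq [:: a; c; b; d] [:: a; b; c; d], perm_eq [:: b; d; a; c] [:: a; b; c; d],
    perm_eq [:: a; d; b; c] [:: a; b; c; d] & perm_eq [:: b; c; a; d] [:: a; b; c; d]].
  by split; apply/permP => P /=; lia.
pose g1 (x : quad) : quad := ((x.2.1, x.2.2), (x.1.1, x.1.2)).
pose g2 (x : quad) : quad := ((x.1.1, x.2.1), (x.1.2, x.2.2)).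
pose g3 (x : quad) : quad := ((x.1.2, x.2.2), (x.1.1, x.2.1)).
pose g4 (x : quad) : quad := ((x.1.1, x.2.2), (x.1.2, x.2.1)).
pose g5 (x : quad) : quad := ((x.1.2, x.2.1), (x.1.1, x.2.2)).
have sum1 (F : quad -> nat) : \sum_(x | distinct4 x) F (g1 x) = \sum_(x | distinct4 x) F x.
  by apply: reindex_quad => [|x]; [move=> [[? ?] [? ?]] [[? ?] [? ?]] [-> -> -> ->]
    | case: (perm4 x.1.1 x.1.2 x.2.1 x.2.2)].
have sum2 (F : quad -> nat) : \sum_(x | distinct4 x) F (g2 x) = \sum_(x | distinct4 x) F x.
  by apply: reindex_quad => [|x]; [move=> [[? ?] [? ?]] [[? ?] [? ?]] [-> -> -> ->]
    | case: (perm4 x.1.1 x.1.2 x.2.1 x.2.2)].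
have sum3 (F : quad -> nat) : \sum_(x | distinct4 x) F (g3 x) = \sum_(x | distinct4 x) F x.
  by apply: reindex_quad => [|x]; [move=> [[? ?] [? ?]] [[? ?] [? ?]] [-> -> -> ->]
    | case: (perm4 x.1.1 x.1.2 x.2.1 x.2.2)].
have sum4 (F : quad -> nat) : \sum_(x | distinct4 x) F (g4 x) = \sum_(x | distinct4 x) F x.
  by apply: reindex_quad => [|x]; [move=> [[? ?] [? ?]] [[? ?] [? ?]] [-> -> -> ->]
    | case: (perm4 x.1.1 x.1.2 x.2.1 x.2.2)].
have sum5 (F : quad -> nat) : \sum_(x | distinct4 x) F (g5 x) = \sum_(x | distinct4 x) F x.
  by apply: reindex_quad => [|x]; [move=> [[? ?] [? ?]] [[? ?] [? ?]] [-> -> -> ->]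
    | case: (perm4 x.1.1 x.1.2 x.2.1 x.2.2)].
have crossE : #|[set x | distinct4 x && crossing x]| = \sum_(x | distinct4 x) crossing x.
  rewrite -sum1_card big_mkcond [RHS]big_mkcond; apply: eq_bigr => x _.
  by rewrite inE; case: (distinct4 x); case: (crossing x).
have : \sum_(x | distinct4 x) 3 <= \sum_(x | distinct4 x)
    (separates x + separates (g1 x) + separates (g2 x) + separates (g3 x)
     + separates (g4 x) + separates (g5 x)
     + crossing x + crossing (g2 x) + crossing (g4 x)).
  by apply: leq_sum => -[[p q] [r s]] /separates_three.
rewrite !big_split /=.
rewrite (sum1 (fun x => separates x : nat)) (sum2 (fun x => separates x : nat)).
rewrite (sum3 (fun x => separates x : nat)) (sum4 (fun x => separates x : nat)).
rewrite (sum5 (fun x => separates x : nat)) (sum2 (fun x => crossing x : nat)).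
rewrite (sum4 (fun x => crossing x : nat)) -crossE -/num_separations.
rewrite sum_nat_const -card_distinct4.
have -> : #|[pred x | distinct4 x]| = #|[set x | distinct4 x]|.
  by apply: eq_card => x; rewrite !inE.
by move: #|_| #|_| num_separations => a c e; clear; lia.
Qed.

End Quadruples.

(** * Counting separations in an allowable sequence *)

Section Separations.
Variables (T : finType) (S : allowable_sequence T).

Lemma left_start p q : left S p q p = false.
Proof. exact: before_irr. Qed.

Lemma left_end p q : left S p q q = false.
Proof.
have [->|pq] := eqVneq p q; first exact: before_irr.
by case/andP: (swap_timeP S pq) => /before_asym.
Qed.

(** For a fixed first pair, the second pair takes one point on each side, in either
    order. *)
Lemma num_separations_left : num_separations (left S) =
  2 * \sum_(x : T * T | [&& x.1 \in [set: T], x.2 \in [set: T] & x.1 != x.2])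
        ell S [set: T] x.1 x.2 * ell S [set: T] x.2 x.1.
Proof.
rewrite /num_separations big_distrr /= [RHS]big_mkcond /=.
rewrite big_mkcond -(pair_bigA _ (fun y z : T * T => if distinct4 (y, z)
   then separates (left S) (y, z) : nat else 0)) /=.
apply: eq_bigr => -[p q] _ /=; rewrite !inE /=.
have [->|pq] := eqVneq p q.
  by apply: big1 => z _; rewrite /distinct4 /= inE eqxx.
pose L := [set r in [set: T] | left S p q r]; pose L' := [set r in [set: T] | left S q p r].
have LL : [disjoint L & L'].
  apply/pred0P => r; rewrite /= !inE /=; have [->|rp] := eqVneq r p.
    by rewrite left_start.
  have [->|rq] := eqVneq r q; first by rewrite left_end.
  by rewrite (@left_rev _ S p q) // andbN.
transitivity #|finset.setX L L' :|: finset.setX L' L|; last first.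
  rewrite cardsU finset.disjoint_setI0 ?cards0 ?subn0.
    by rewrite !cardsX /ell mul2n -addnn [in X in _ + X]mulnC.
  apply/pred0P => -[r s] /=; rewrite !finset.in_setX; apply/negbTE/negP.
  by move=> /andP[/andP[h1 _] /andP[h2 _]]; have /pred0P/(_ r) := LL; rewrite /= h1 h2.
rewrite -sum1_card [RHS]big_mkcond; apply: eq_bigr => -[r s] _ /=.
rewrite finset.in_setU !finset.in_setX !inE /= /separates /distinct4 /= !inE (negbTE pq) /=.
have [->|pr] := eqVneq p r; first by rewrite left_start left_end.
have [->|ps] := eqVneq p s; first by rewrite left_start left_end !andbF.
have [->|qr] := eqVneq q r; first by rewrite left_start left_end.
have [->|qs] := eqVneq q s; first by rewrite left_start left_end !andbF.
rewrite [in LHS]/= !(@left_rev _ S p q) // 1?eq_sym //.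
have [->|rs] := eqVneq r s; first by case: (left S p q s).
by case: (left S p q r); case: (left S p q s).
Qed.

End Separations.

Lemma card_fibers (I : finType) (K : eqType) (f : I -> K) (s : seq K) m (X : {set I}) :
  (forall x, x \in X -> f x \in s) ->
  (forall x0, x0 \in X -> #|[set x in X | f x == f x0]| <= m) -> #|X| <= m * size s.
Proof.
elim: s X => [|y s IH] X Xs Xm.
  rewrite muln0 leqn0 cards_eq0; apply/eqP/setP => x; rewrite inE.
  by apply/negP => /Xs.
rewrite -(cardsID [set x | f x == y]) mulnS leq_add //.
  have [->|[x0]] := set_0Vmem (X :&: [set x | f x == y]); first by rewrite cards0.
  rewrite !inE => /andP[x0X /eqP <-].
  by apply: leq_trans (Xm x0 x0X); apply/eq_leq/eq_card => x; rewrite !inE.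
apply: IH => [x|x0]; rewrite !inE; first by case/andP => /negbTE xy /Xs; rewrite inE xy.
move=> /andP[_ /Xm]; apply: leq_trans.
by apply/subset_leq_card/fintype.subsetP => x; rewrite !inE => /andP[/andP[_ ->] ->].
Qed.

(** * Crossings of a planar point set *)

Section Crossings.
Variables (R : realType) (P : {fset R * R}).
Hypothesis P_general : general_position P.
Local Open Scope ring_scope.
Local Open Scope fset_scope.

Let pt (p : P) : R * R := val p.

Lemma pt_general (p q r : P) : p != q -> p != r -> q != r ->
  det (pt p) (pt q) (pt r) != 0.
Proof.
move=> pq pr qr; apply/eqP => D.
have := @P_general _ _ _ (valP p) (valP q) (valP r).
rewrite !(inj_eq val_inj) => /(_ pq pr qr); apply.
exists ((pt q).2 - (pt p).2), (- ((pt q).1 - (pt p).1)).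
exists (((pt q).2 - (pt p).2) * (pt p).1 - ((pt q).1 - (pt p).1) * (pt p).2).
split; last by move: D; rewrite /det => D; split; lra.
apply: contra pq => /eqP [e2 e1]; apply/eqP/val_inj.
move: e1 e2; rewrite -/(pt p) -/(pt q); case: (pt p) (pt q) => [a b] [c d] /= e1 e2.
by congr (_, _); lra.
Qed.

Variable S : allowable_sequence P.
Hypothesis left_det : forall p q r : P, p != q -> p != r -> q != r ->
  left S p q r = (det (pt p) (pt q) (pt r) < 0).

Definition crossing_of (x : (P * P) * (P * P)) : {fset {fset R * R}} :=
  [fset [fset pt x.1.1; pt x.1.2]; [fset pt x.2.1; pt x.2.2]].

Lemma distinct4P (x : (P * P) * (P * P)) : distinct4 x ->
  [/\ x.1.1 != x.1.2, x.2.1 != x.2.2 & [/\ x.1.1 != x.2.1, x.1.1 != x.2.2,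
     x.1.2 != x.2.1 & x.1.2 != x.2.2]].
Proof.
rewrite /distinct4 /= !inE !negb_or -!andbA.
by move=> /and5P[-> -> -> -> /andP[-> /andP[-> _]]].
Qed.

Lemma pair_fset_inj (p q p' q' : P) : p != q ->
  [fset pt p; pt q] = [fset pt p'; pt q'] -> (p, q) = (p', q') \/ (p, q) = (q', p').
Proof.
move=> pq /fsetP E; have := E (pt p); have := E (pt q).
rewrite !inE !eqxx orbT /= !(inj_eq val_inj).
move=> /esym/orP[]/eqP e1 /esym/orP[]/eqP e2; subst.
- by rewrite eqxx in pq.
- by right.
- by left.
- by rewrite eqxx in pq.
Qed.

Lemma edge_neq (p q r s : P) : p != r -> p != s ->
  [fset pt p; pt q] != [fset pt r; pt s].
Proof.
move=> pr ps; apply/eqP => /fsetP/(_ (pt p)).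
by rewrite !inE eqxx /= !(inj_eq val_inj) (negbTE pr) (negbTE ps).
Qed.

Lemma edge_in (p q : P) : p != q -> [fset pt p; pt q] \in edges P.
Proof.
move=> pq; rewrite !inE /= fpowersetE cardfs2 (inj_eq val_inj) pq andbT.
by apply/fsubsetP => z; rewrite !inE => /orP[]/eqP->; apply: valP.
Qed.

Lemma crossing_of_in x : distinct4 x -> crossing (left S) x ->
  crossing_of x \in crossings P.
Proof.
move: x => [[p q] [r s]] /distinct4P /= [pq rs [pr ps qr qs]].
have [rp sp rq sq] : [/\ r != p, s != p, r != q & s != q].
  by rewrite ![r == _]eq_sym ![s == _]eq_sym.
rewrite /crossing /separates /= (left_det pq pr qr) (left_det pq ps qs).
rewrite (left_det rs rp sp) (left_det rs rq sq) => /andP[h1 h2].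
have opp (a b : R) : a != 0 -> b != 0 -> (a < 0) != (b < 0) -> a * b < 0.
  move=> a0 b0; case: (ltrgtP a 0) a0 => // a0 _; case: (ltrgtP b 0) b0 => // b0 _ _.
    by rewrite nmulr_rlt0.
  by rewrite pmulr_rlt0.
have [t [u [ht hu E]]] := segments_cross
  (opp _ _ (pt_general pq pr qr) (pt_general pq ps qs) h1)
  (opp _ _ (pt_general rs rp sp) (pt_general rs rq sq) h2).
rewrite !inE /= fpowersetE cardfs2 edge_neq //=; apply/andP; split.
  by apply/fsubsetP => z; rewrite in_fset2 => /orP[]/eqP->; apply: edge_in.
apply/asboolP; exists [fset pt p; pt q], [fset pt r; pt s]; split=> //.
exists (pt p), (pt q), (pt r), (pt s); split=> //.
exists ((1 - t) * (pt p).1 + t * (pt q).1, (1 - t) * (pt p).2 + t * (pt q).2)%R.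
by split; [exists t | exists u].
Qed.

(** The two segments can be exchanged, and each of them reversed. *)
Lemma card_crossing_of_fiber x0 : distinct4 x0 ->
  (#|[set x | distinct4 x & crossing_of x == crossing_of x0]| <= 8)%N.
Proof.
move: x0 => [[p q] [r s]] d0; have /= [pq rs [pr ps qr qs]] := distinct4P d0.
pose l := [:: ((p, q), (r, s)); ((p, q), (s, r)); ((q, p), (r, s)); ((q, p), (s, r));
  ((r, s), (p, q)); ((r, s), (q, p)); ((s, r), (p, q)); ((s, r), (q, p))].
apply: leq_trans (_ : #|l| <= 8)%N; last exact: card_size.
apply/subset_leq_card/fintype.subsetP => -[[p' q'] [r' s']].
rewrite inE => /andP[d /eqP /fsetP E]; have /= [pq' rs' [pr' ps' qr' qs']] := distinct4P d.
have := E [fset pt p'; pt q']; have := E [fset pt r'; pt s'].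
rewrite !in_fset2 !eqxx orbT /= => /esym/orP[]/eqP E2 /esym/orP[]/eqP E1.
- by case/eqP: (edge_neq q' pr' ps'); rewrite E1 E2.
- by case: (pair_fset_inj pq' E1) => -[-> ->]; case: (pair_fset_inj rs' E2) => -[-> ->];
    rewrite !inE !eqxx ?orbT.
- by case: (pair_fset_inj pq' E1) => -[-> ->]; case: (pair_fset_inj rs' E2) => -[-> ->];
    rewrite !inE !eqxx ?orbT.
- by case/eqP: (edge_neq q' pr' ps'); rewrite E1 E2.
Qed.

Lemma card_crossings_ge :
  (#|[set x | distinct4 x && crossing (left S) x]| <= 8 * cr P)%N.
Proof.
apply: (@card_fibers _ _ crossing_of (enum_fset (crossings P))) => [x|x].
  by rewrite inE => /andP[]; apply: crossing_of_in.
rewrite inE => /andP[d _]; apply: leq_trans (card_crossing_of_fiber d).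
apply/subset_leq_card/fintype.subsetP => y; rewrite !inE.
by move=> /andP[/andP[-> _] ->].
Qed.

Lemma falling_le_cr :
  (#|{: P}| ^_ 4 <= 2 * num_separations (left S) + 8 * cr P)%N.
Proof.
apply: leq_trans (_ : _ <= 2 * num_separations (left S) +
   #|[set x | distinct4 x && crossing (left S) x]|)%N _; last first.
  by rewrite leq_add2l card_crossings_ge.
apply: falling_le_separations.
- move=> p q r pq pr qr; have [qp rp] : q != p /\ r != p by rewrite ![_ == p]eq_sym.
  by rewrite (left_det pq pr qr) (left_det qr qp rp) det_rot.
- move=> p q r pq pr qr; have [rp rq] : r != p /\ r != q by rewrite ![r == _]eq_sym.
  exact: left_rev.
- move=> p q r s U; have /distinct4P /= [pq rs [pr ps qr qs]] :
    @distinct4 P ((p, q), (r, s)) by [].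
  rewrite (left_det pq pr qr) (left_det pq ps qs) (left_det pr ps rs) (left_det qr qs rs).
  have := det_four (pt p) (pt q) (pt r) (pt s).
  have := pt_general pq pr qr; have := pt_general pq ps qs.
  have := pt_general pr ps rs; have := pt_general qr qs rs; rewrite /pt.
  move: (det _ _ _) (det _ _ _) (det _ _ _) (det _ _ _) => a b c d a0 b0 c0 d0 E.
  case: (ltrgtP a 0) a0 => // a0 _; case: (ltrgtP b 0) b0 => // b0 _;
  case: (ltrgtP c 0) c0 => // c0 _; case: (ltrgtP d 0) d0 => // d0 _ //=; lra.
Qed.

End Crossings.

Lemma pow4_le_ffact n : (n ^ 4 <= n ^_ 4 + 6 * n ^ 3)%N.
Proof.
have [n3|n3] := leqP n 3.
  by apply: leq_trans (leq_addl _ _); rewrite expnS leq_mul2r; clear -n3; lia.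
have [k ->] : exists k, n = k.+4 by exists (n - 4); clear -n3; lia.
rewrite !ffactnS ffactn0 /= !expnS expn0 !muln1 /=.
clear; nia.
Qed.

(** With s the sum bounded in [sum_ell_mul_le], [8 cr >= n ^_ 4 - 4 s] and
    [s <= 955 / 4374 * n ^ 4] up to a cubic term, and
    [24 / 8 * (1 - 4 * 955 / 4374) = 277 / 729]. *)
Lemma cr_ge (R : realType) (P : {fset R * R}) : general_position P ->
  (277 / 729 * 'C(#|` P|, 4)%:R - 100 * #|` P|%:R ^+ 3 <= (cr P)%:R :> R)%R.
Proof.
move=> gp; rewrite cardfE; set n := #|{: P}|.
have n0 : (0 <= n%:R ^+ 3 :> R)%R by rewrite exprn_ge0.
have [n1|n1] := leqP n 1.
  rewrite bin_small; last by clear -n1; lia.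
  by apply: le_trans (ler0n _ _); rewrite mulr0; lra.
pose S := point_sequence val_inj (pt_general gp) n1.
have H1 := falling_le_cr gp (S := S) (left_point_sequence val_inj (pt_general gp) n1).
have H2 := sum_ell_mul_le S [set: P] R.
rewrite cardsT -/n in H2.
have H3 := pow4_le_ffact n.
have H4 : ((n ^_ 4)%:R = 24 * 'C(n, 4)%:R :> R)%R.
  by rewrite -bin_ffact natrM mulrC.
move: H1 H3 H4; rewrite -/n num_separations_left; move: (n ^_ 4) => f.
rewrite -!(ler_nat R) !natrD !natrM; move: H2 n0.
move: (\sum_(x | _) _)%:R%R (f%:R)%R => s e.
move: (n%:R)%R ('C(n, 4)%:R)%R ((cr P)%:R)%R => x z c.
lra.
Qed.

Local Open Scope ring_scope.

Theorem theorem3 (R : realType) :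
  (277 / 729 : R) > 379972%:R / 10 ^+ 6 /\
  exists C : R, 0 < C /\
    forall n : nat, (0 < n)%N ->
      (rectilinear_cr R n)%:R >= 277 / 729 * 'C(n, 4)%:R - C * n%:R ^+ 3.
Proof.
split; first by lra.
exists 100; split=> [|n _]; first by lra.
rewrite /rectilinear_cr; case: ex_minnP => k /asboolP[P [<- gp <-]] _.
exact: cr_ge.
Qed.
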